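(* Let $\lambda\in\mathbb{R}$ be an algebraic number of degree $d$ with minimal polynomial $p(x)=a_dx^d+\cdots+a_0\in\mathbb{Z}[x]$, where $a_0,\dots,a_d$ have no common prime factor. Then there are constants $D>0$ and $\sigma>0$ such that $$|A+\lambda\cdot A|\geq \left(|a_d|^{1/d}+|a_0|^{1/d}\right)^d|A|-D|A|^{1-\sigma}$$ holds for all finite subsets $A$ of $\mathbb{R}$.
   Context: For a set $A$ and scalar $\lambda$, $\lambda\cdot A=\{\lambda a:a\in A\}$ and $A+\lambda\cdot A=\{a+\lambda b: a,b\in A\}$. *)

(* Defs.v *)
From HB Require Import structures.
From mathcomp Require Import all_boot all_order all_algebra.
From mathcomp Require Import finmap.
From mathcomp Require Import all_classical all_reals all_analysis.
Set Implicit Arguments. Unset Strict Implicit. Unset Printing Implicit Defensive.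
Import Order.TTheory GRing.Theory Num.Theory.
Local Open Scope ring_scope.
Local Open Scope fset_scope.

Definition is_min_poly_int (R : realType) (lam : R) (p : {poly int}) : Prop :=
  [/\ p != 0,
      (map_poly (fun z : int => z%:~R : R) p).[lam] = 0 &
      forall q : {poly rat}, q != 0 ->
        (map_poly (fun r : rat => ratr r : R) q).[lam] = 0 ->
        (size p <= size q)%N].

Definition primitive_int_poly (p : {poly int}) : Prop :=
  forall q : nat, prime q -> exists i : nat, ~~ (q%:Z %| p`_i)%Z.

Definition sumset_dil (R : realType) (A : {fset R}) (lam : R) : {fset R} :=
  [fset (a + lam * b)%R | a in A, b in A].

(* Main.v *)
Require Import Defs.
From HB Require Import structures.
From mathcomp Require Import all_boot all_order all_algebra.
From mathcomp Require Import finmap.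
From mathcomp Require Import all_classical all_reals all_analysis.
From mathcomp Require Import ring lra zify.
Import Order.TTheory GRing.Theory Num.Theory.
Local Open Scope fset_scope.
Local Open Scope ring_scope.
Set Implicit Arguments. Unset Strict Implicit. Unset Printing Implicit Defensive.

(* Let [c] be the constant of the theorem, [n = |A|], and let [L] be the group generated
   by the differences of [A]. If [|A + lam A| <= c n], then by Pluennecke's inequality and
   a pigeonhole argument producing long progressions in sums of [A - A], the set
   [A + lam A] lies on [O(n^(1-s))] cosets of each of [Z z, Z lam z, ..., Z lam^(d-1) z]
   for some [z <> 0]; a discrete Brunn-Minkowski inequality then gives
   [|X + lam Y| >= (|X|^(1/d) + |Y|^(1/d))^d - O(n^(1-s))] for nonempty [X, Y] in [A].

   The bound follows by induction on [n]. Split [A] into rows (classes modulo [lam L]) and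
   columns (classes modulo [L / lam]): the sums of distinct pairs (row, column) are
   disjoint, so the induction hypothesis applied to the cells nearly suffices, the
   concavity of [x^(1-sigma)] costing only a factor close to 1; any gain of order
   [n^(1-sigma)] in a single cell finishes. There is such a gain if some cell is small, or
   if some cell does not meet all classes modulo [lam^2 L] (or [L / lam^2]) that it could.
   Otherwise each cell has at least [L : lam L] subrows and [lam^-1 L : L] subcolumns;
   these indices are at least [|a_0|] and [|a_d|] by Gauss's lemma. Either the cell is
   evenly distributed among them, and Brunn-Minkowski for each pair (subrow, subcolumn)
   gives the constant [c], or the unevenness is again a gain. *)

(** The group [L] need not be stable under [lam]: the index [[L : lam L]] is that of the
    intersection with [L], while classes modulo [lam L] make sense for all reals.

    Nothing forces [A] itself to meet many classes modulo [lam L], so fullness is examined one level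
    down. A cell lies in one class modulo [lam L]; adding [lam] times its column moves it among the
    subclasses modulo [lam^2 L], so a subclass that the cell misses betrays new sums.

    The constant comes from scaling. A cell of size [N] spread evenly over [P] subrows and [Q]
    subcolumns has [P Q] disjoint sums, each of size about [((N/P)^(1/d) + (N/Q)^(1/d))^d]; together
    they give [N (Q^(1/d) + P^(1/d))^d].

    Splitting into [k] parts multiplies the permitted loss [D n^(1-sigma)] by at most [k^sigma].
    Since [k] is bounded in terms of [c], a small [sigma] makes this factor at most [1 + eta], and
    one gain of [eta D n^(1-sigma)] repays it. The Brunn-Minkowski error must stay below that gain,
    hence must save a power of [n]. *)

(** * Counting in finite sets *)

Section FsetCounting.
Variables T U : choiceType.

Lemma leq_card_inj (f : T -> U) (A : {fset T}) (B : {fset U}) :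
  {in A &, injective f} -> {in A, forall x, f x \in B} -> (#|` A| <= #|` B|)%N.
Proof.
move=> fI fB; rewrite -(card_in_imfset imfset_key fI).
by apply: fsubset_leq_card; apply/fsubsetP => y /imfsetP[x /= xA ->]; apply: fB.
Qed.

Lemma card_partition (f : T -> U) (A : {fset T}) :
  #|` A| = (\sum_(i <- f @` A) #|` [fset x in A | f x == i]|)%N.
Proof.
rewrite card_fset_sum1 (partition_big_imfset _ f) /=; apply: eq_bigr => i _.
by rewrite card_fset_sum1 big_fset_condE.
Qed.

Lemma cardfsM (A : {fset T}) (B : {fset U}) :
  #|` A `*` B| = (#|` A| * #|` B|)%N.
Proof.
rewrite card_fset_sum1 /fsetM big_imfset2 /=; last by move=> [a b] [a' b'] _ _ /= [-> ->].
under eq_bigr do rewrite -card_fset_sum1.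
by rewrite big_const_seq count_predT iter_addn_0 mulnC.
Qed.

End FsetCounting.

(** * Sumsets in an abelian group and Ruzsa's triangle inequality *)

Section Sumset.
Variable V : zmodType.
Implicit Types A B C D X Y : {fset V}.

Definition addf A B : {fset V} := [fset a + b | a in A, b in B].
Definition oppf A : {fset V} := [fset - a | a in A].
Definition mulnf k A : {fset V} := iter k (addf A) [fset 0].

Lemma addfP A B x :
  reflect (exists a b, [/\ a \in A, b \in B & x = a + b]) (x \in addf A B).
Proof.
apply: (iffP (imfset2P _ _ _ _ _)) => [[a /= aA [b /= bB ->]]|[a [b [aA bB ->]]]].
  by exists a, b.
by exists a => //; exists b.
Qed.

Lemma mem_addf A B a b : a \in A -> b \in B -> a + b \in addf A B.
Proof. by move=> aA bB; apply/addfP; exists a, b. Qed.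

Lemma mem_oppf A x : (x \in oppf A) = (- x \in A).
Proof.
apply/imfsetP/idP => [[a /= aA ->]|xA]; first by rewrite opprK.
by exists (- x); rewrite ?opprK.
Qed.

Lemma addfC A B : addf A B = addf B A.
Proof.
by apply/fsetP => x; apply/addfP/addfP => -[a [b [aA bB ->]]];
   exists b, a; rewrite addrC.
Qed.

Lemma addfA A B C : addf A (addf B C) = addf (addf A B) C.
Proof.
apply/fsetP => x; apply/addfP/addfP.
  move=> [a [_ [aA /addfP[b [c [bB cC ->]]] ->]]].
  by exists (a + b), c; rewrite mem_addf // addrA.
move=> [_ [c [/addfP[a [b [aA bB ->]]] cC ->]]].
by exists a, (b + c); rewrite mem_addf // addrA.
Qed.

Lemma addfACA A B C D : addf (addf A B) (addf C D) = addf (addf A C) (addf B D).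
Proof. by rewrite -!addfA (addfA B) (addfC B) -addfA. Qed.

Lemma addfS A A' B B' : A `<=` A' -> B `<=` B' -> addf A B `<=` addf A' B'.
Proof.
move=> /fsubsetP sA /fsubsetP sB; apply/fsubsetP => _ /addfP[a [b [aA bB ->]]].
by rewrite mem_addf ?sA ?sB.
Qed.

Lemma oppfS A A' : A `<=` A' -> oppf A `<=` oppf A'.
Proof.
by move=> /fsubsetP sA; apply/fsubsetP => x; rewrite !mem_oppf; apply: sA.
Qed.

Lemma oppfD A B : oppf (addf A B) = addf (oppf A) (oppf B).
Proof.
apply/fsetP => x; rewrite mem_oppf; apply/addfP/addfP => -[a [b [aA bB e]]].
  by exists (- a), (- b); rewrite !mem_oppf !opprK -opprD -e opprK.
by move: aA bB; rewrite !mem_oppf => aA bB; exists (- a), (- b);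
  rewrite -opprD e.
Qed.

Lemma oppfK A : oppf (oppf A) = A.
Proof. by apply/fsetP => x; rewrite !mem_oppf opprK. Qed.

Lemma card_oppf A : #|` oppf A| = #|` A|.
Proof. by rewrite card_imfset //; apply: oppr_inj. Qed.

Lemma leq_card_addf A B : (#|` addf A B| <= #|` A| * #|` B|)%N.
Proof.
rewrite -cardfsM; apply: (@leq_trans #|` [fset p.1 + p.2 | p in A `*` B]|).
  apply: fsubset_leq_card; apply/fsubsetP => _ /addfP[a [b [aA bB ->]]].
  by apply/imfsetP; exists (a, b); rewrite //= in_fsetM aA bB.
exact: leq_imfset_card.
Qed.

Lemma leq_card_addfl A B : B != fset0 -> (#|` A| <= #|` addf A B|)%N.
Proof.
case/fset0Pn => b bB; apply: (@leq_card_inj _ _ (fun a => a + b)).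
  by move=> x y _ _ /addIr.
by move=> x xA; apply: mem_addf.
Qed.

Lemma leq_card_addfr A B : A != fset0 -> (#|` B| <= #|` addf A B|)%N.
Proof. by move=> A0; rewrite addfC leq_card_addfl. Qed.

Lemma addf_neq0 A B : A != fset0 -> B != fset0 -> addf A B != fset0.
Proof.
by move=> /fset0Pn[a aA] /fset0Pn[b bB]; apply/fset0Pn; exists (a + b); rewrite mem_addf.
Qed.

Lemma addf0 A : addf A [fset 0] = A.
Proof.
apply/fsetP => x; apply/addfP/idP => [[a [b [aA /fset1P -> ->]]]|xA].
  by rewrite addr0.
by exists x, 0; rewrite xA inE eqxx addr0.
Qed.

Lemma mulnfS k A : mulnf k.+1 A = addf A (mulnf k A). Proof. by []. Qed.

Lemma mulnf0 A : mulnf 0 A = [fset 0]. Proof. by []. Qed.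

Lemma mulnf1 A : mulnf 1 A = A. Proof. by rewrite mulnfS addf0. Qed.

Lemma mulnfD k l A : mulnf (k + l) A = addf (mulnf k A) (mulnf l A).
Proof.
elim: k => [|k IHk]; first by rewrite add0n mulnf0 addfC addf0.
by rewrite addSn !mulnfS IHk addfA.
Qed.

Lemma oppf_mulnf k A : oppf (mulnf k A) = mulnf k (oppf A).
Proof.
elim: k => [|k IHk].
  by apply/fsetP => x; rewrite mem_oppf !inE oppr_eq0.
by rewrite !mulnfS oppfD IHk.
Qed.

Lemma mulnfDr k A B : mulnf k (addf A B) = addf (mulnf k A) (mulnf k B).
Proof.
elim: k => [|k IHk]; first by rewrite !mulnf0 addf0.
by rewrite !mulnfS IHk -!addfA; congr addf; rewrite addfA (addfC B) -addfA.
Qed.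

Lemma mulnfSr k A B : A `<=` B -> mulnf k A `<=` mulnf k B.
Proof.
by move=> AB; elim: k => [|k IHk]; rewrite ?fsubset_refl // !mulnfS addfS.
Qed.

Lemma card_mulnf k A : (#|` mulnf k A| <= #|` A| ^ k)%N.
Proof.
elim: k => [|k IHk]; first by rewrite mulnf0 cardfs1.
by rewrite mulnfS expnS (leq_trans (leq_card_addf _ _)) // leq_mul2l IHk orbT.
Qed.

(** Fix one representation [b - c] of each difference. The map sending [x] and [b - c] to the pair
    [(x + b, x + c)] is injective: the difference of the coordinates recovers [b] and [c], and then
    [x]. *)
Lemma ruzsa_triangle X B C :
  (#|` X| * #|` addf B (oppf C)| <= #|` addf X B| * #|` addf X C|)%N.
Proof.
have /choice[f fP] : forall x : V, exists p : V * V,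
    x \in addf B (oppf C) -> [/\ p.1 \in B, p.2 \in C & x = p.1 - p.2].
  move=> x; have [/addfP[b [c [bB cC ->]]]|xN] := boolP (x \in addf B (oppf C)); last by exists (0, 0).
  by exists (b, - c); move: cC; rewrite mem_oppf opprK.
rewrite -!cardfsM; apply: (@leq_card_inj _ _ (fun p => (p.1 + (f p.2).1, p.1 + (f p.2).2))).
  move=> [x y] [x' y']; rewrite !in_fsetM /= => /andP[_ yD] /andP[_ y'D] [e1 e2].
  have [_ _ ey] := fP _ yD; have [_ _ ey'] := fP _ y'D.
  have yy' : y = y'.
    have shift (t a b : V) : a - b = (t + a) - (t + b).
      by rewrite opprD addrACA subrr add0r.
    by rewrite ey ey' (shift x) e1 e2 -shift.
  by rewrite -yy' in e1 *; rewrite (addIr _ e1).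
move=> [x y]; rewrite !in_fsetM /= => /andP[xX /fP[? ? _]].
by rewrite !mem_addf.
Qed.

End Sumset.

(** * Pluennecke's inequality by Petridis's method, and Ruzsa's covering lemma *)

Section Plunnecke.
Variables (V : zmodType) (R : realType).
Implicit Types A B C X Y S : {fset V}.
Local Notation card A := (#|` A|%:R : R).

(** Descent on the size: if the ratio [K0] of a set is not minimal among its subsets, some proper
    nonempty subset has a smaller ratio. *)
Lemma min_ratio_subset B (K : R) A : A != fset0 -> card (addf A B) <= K * card A ->
  exists X K0, [/\ X `<=` A, X != fset0, K0 <= K, card (addf X B) = K0 * card X &
    forall Y, Y `<=` X -> K0 * card Y <= card (addf Y B)].
Proof.
have [n] := ubnP #|` A|; elim: n A => // n IHn A An A0 AK.
have cA0 : 0 < card A by rewrite ltr0n cardfs_gt0.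
have [Amin|] := pselect (forall Y, Y `<=` A ->
    card (addf A B) / card A * card Y <= card (addf Y B)).
  exists A, (card (addf A B) / card A); split=> //.
    by rewrite ler_pdivrMr.
  by rewrite divfK // gt_eqF.
move=> /existsNP[Y /not_implyP[YA /negP]]; rewrite -ltNge => Ylt.
have Y0 : Y != fset0.
  by apply/eqP => Y0; move: Ylt; rewrite Y0 cardfs0 mulr0 ltNge ler0n.
have YltA : (#|` Y| < #|` A|)%N.
  rewrite ltn_neqAle fsubset_leq_card // andbT; apply/eqP => YA'.
  have YEA : Y = A by apply/eqP; rewrite eqEfcard YA YA' leqnn.
  by move: Ylt; rewrite YEA divfK ?gt_eqF// ltxx.
have AKY : card (addf A B) / card A <= K by rewrite ler_pdivrMr.
have [||X [K0 [XY X0 K0K XB Xmin]]] := IHn Y _ Y0.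
- exact: leq_trans YltA _.
- by rewrite (le_trans (ltW Ylt)) // ler_wpM2r.
- by exists X, K0; split=> //; apply: fsubset_trans XY YA.
Qed.

(** [X] minimises [|X + B| / |X|], and [C] grows one element [c] at a time. If [Z] is the part of
    [X] with [Z + c] already in [X + C], then [Z + B + c] is already in [X + B + C]; minimality
    bounds [|Z + B|] from below by [K0 |Z|], which is what the increment on the other side needs. *)
Lemma petridis A B (K : R) : A != fset0 -> card (addf A B) <= K * card A ->
  exists X, [/\ X `<=` A, X != fset0 &
    forall C, card (addf (addf X B) C) <= K * card (addf X C)].
Proof.
move=> A0 /(min_ratio_subset A0)[X [K0 [XA X0 K0K XB Xmin]]].
exists X; split=> // C; apply: le_trans (_ : K0 * card (addf X C) <= _); last first.
  by rewrite ler_wpM2r.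
elim/fset1U_rect: C => [|c C cC IHC].
  have addX0 Y : addf Y fset0 = fset0.
    by apply/eqP/fset0Pn => -[x /addfP[a [b []]]]; rewrite inE.
  by rewrite !addX0 cardfs0 mulr0.
pose T Y := [fset y + c | y in Y].
have TP Y x : reflect (exists2 y, y \in Y & x = y + c) (x \in T Y) by exact: imfsetP.
have cardT Y : #|` T Y| = #|` Y| by rewrite card_imfset //; apply: addIr.
have addU Y : addf Y (c |` C) = addf Y C `|` T Y.
  apply/fsetP => x; rewrite in_fsetU; apply/addfP/orP.
    move=> [a [b [aY]]]; rewrite in_fset1U => /orP[/eqP -> ->|bC ->].
      by right; apply/TP; exists a.
    by left; rewrite mem_addf.
  move=> [/addfP[a [b [aY bC ->]]]|/TP[a aY ->]].
    by exists a, b; rewrite in_fset1U bC orbT.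
  by exists a, c; rewrite in_fset1U eqxx.
pose Z := [fset x in X | x + c \in addf X C].
have ZX : Z `<=` X by apply/fsubsetP => x; rewrite !inE /= => /andP[].
have cXC : (#|` addf X (c |` C)| + #|` Z| = #|` addf X C| + #|` X|)%N.
  rewrite addU -(cardT X) -[in RHS]cardfsUI; congr (_ + _)%N.
  rewrite -(cardT Z); congr #|` _|; apply/fsetP => x; rewrite in_fsetI.
  apply/TP/andP => [[z]|[xXC /TP[y yX xE]]].
    by rewrite !inE /= => /andP[zX zc] ->; split=> //; apply/TP; exists z.
  by exists y; rewrite // !inE yX /= -xE.
have cXBC : (#|` addf (addf X B) (c |` C)| + #|` addf Z B| <=
             #|` addf (addf X B) C| + #|` addf X B|)%N.
  rewrite addU -(cardT (addf X B)) -[leqRHS]cardfsUI leq_add2l -(cardT (addf Z B)).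
  apply: fsubset_leq_card; apply/fsubsetP => x /TP[_ /addfP[z [b [zZ bB ->]]] ->].
  have zX := fsubsetP ZX _ zZ; rewrite in_fsetI; apply/andP; split; last first.
    by apply/TP; exists (z + b) => //; rewrite mem_addf.
  move: zZ; rewrite !inE /= => /andP[_ /addfP[a [e [aX eC zE]]]].
  by rewrite addrAC zE addrAC mem_addf // mem_addf.
have ZB := Xmin _ ZX.
have := cXBC; rewrite -(ler_nat R) !natrD => h1.
have := congr1 (fun n => n%:R : R) cXC; rewrite !natrD => h2.
rewrite -(lerD2r (card (addf Z B))) (le_trans h1) // XB.
rewrite (le_trans (lerD IHC (lexx _))) // -mulrDr -h2 mulrDr lerD2l //.
Qed.

(** Taking for [C] the multiples of [B] in [petridis] costs one factor [K] per summand; the triangle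
    inequality through [X] then passes to the difference. *)
Lemma plunnecke A B (K : R) k l : A != fset0 -> 0 <= K -> card (addf A B) <= K * card A ->
  card (addf (mulnf k B) (oppf (mulnf l B))) <= K ^+ (k + l) * card A.
Proof.
move=> A0 K0 /(petridis A0)[X [XA X0 Xc]].
have XkB m : card (addf X (mulnf m B)) <= K ^+ m * card X.
  elim: m => [|m IHm]; first by rewrite mulnf0 addf0 mul1r.
  rewrite mulnfS addfA (le_trans (Xc _)) // exprS -mulrA ler_wpM2l //.
have cX0 : 0 < card X by rewrite ltr0n cardfs_gt0.
rewrite -(ler_pM2l cX0).
apply: le_trans (_ : card (addf X (mulnf k B)) * card (addf X (mulnf l B)) <= _).
  by rewrite -!natrM ler_nat ruzsa_triangle.
apply: le_trans (_ : (K ^+ k * card X) * (K ^+ l * card X) <= _).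
  by rewrite ler_pM.
have -> : (K ^+ k * card X) * (K ^+ l * card X) = card X * (K ^+ (k + l) * card X).
  by rewrite exprD; ring.
by rewrite ler_wpM2l // ler_wpM2l ?exprn_ge0 // ler_nat fsubset_leq_card.
Qed.

(** [X] is maximal among the subsets of [S] with pairwise disjoint translates [A + x]. Disjointness
    bounds its size; by maximality every [A + s] meets some [A + x], so [s] lies in [x + A - A]. *)
Lemma ruzsa_covering A S (K : R) : A != fset0 -> card (addf A S) <= K * card A ->
  exists X, [/\ X `<=` S, card X <= K & S `<=` addf X (addf A (oppf A))].
Proof.
move=> A0 AS; have cA0 : 0 < card A by rewrite ltr0n cardfs_gt0.
pose ok X := X `<=` S /\ {in X &, forall x y a b, a \in A -> b \in A ->
  a + x = b + y -> x = y}.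
have okcard X : ok X -> card X <= K.
  move=> [XS Xd]; rewrite -(ler_pM2r cA0) (le_trans _ AS) // -natrM ler_nat mulnC -cardfsM.
  apply: (@leq_card_inj _ _ (fun p => p.1 + p.2)).
    move=> [a x] [b y]; rewrite !in_fsetM /= => /andP[aA xX] /andP[bA yX] e.
    by have xy := Xd _ _ xX yX _ _ aA bA e; move: e; rewrite xy => /addIr ->.
  move=> [a x]; rewrite in_fsetM /= => /andP[aA xX].
  by rewrite mem_addf // (fsubsetP XS).
suff: forall n X, (#|` S| - #|` X| <= n)%N -> ok X -> exists2 X', ok X' &
    S `<=` addf X' (addf A (oppf A)).
  move=> H; have [||X oX SX] := H #|` S| fset0; rewrite ?leq_subr //.
  by exists X; split=> //; [case: oX|apply: okcard].
elim=> [|n IHn] X Xn [XS Xd].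
  exists X => //; have -> : X = S.
    by apply/eqP; rewrite eqEfcard XS -subn_eq0 -leqn0.
  apply/fsubsetP => x xS; have /fset0Pn[a aA] := A0.
  by rewrite -[x]addr0 -(subrr a) !mem_addf // mem_oppf opprK.
have [/fsubsetP SX|/fsubsetPn[s sS sN]] := boolP (S `<=` addf X (addf A (oppf A))).
  by exists X => //; apply/fsubsetP.
have sX : s \notin X.
  apply: contra sN => sX; have /fset0Pn[a aA] := A0.
  by rewrite -[s]addr0 -(subrr a) !mem_addf // mem_oppf opprK.
have sN' x a b : x \in X -> a \in A -> b \in A -> a + s = b + x -> False.
  move=> xX aA bA e; move: sN => /negP; apply.
  have -> : s = x + (b - a) by rewrite addrCA addrA -e addrAC subrr add0r.
  by rewrite !mem_addf // mem_oppf opprK.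
apply: (IHn (s |` X)).
  have : (#|` X| < #|` S|)%N.
    by rewrite fproper_ltn_card // fproperE XS; apply/fsubsetPn; exists s.
  by rewrite cardfsU1 sX; lia.
split.
  by apply/fsubsetP => x; rewrite in_fset1U => /orP[/eqP -> //|/(fsubsetP XS)].
move=> x y; rewrite !in_fset1U => /orP[/eqP ->|xX] /orP[/eqP ->|yX] // a b aA bA e.
- by case: (sN' y a b).
- by case: (sN' x b a).
- exact: (Xd _ _ xX yX a b).
Qed.

End Plunnecke.

(** * Cosets of a subgroup given as a predicate *)

Section Cosets.
Variable V : comNzRingType.
Implicit Types (H : V -> Prop) (A B Z : {fset V}).

Definition subgrp H := H 0 /\ forall x y, H x -> H y -> H (x - y).

Lemma subgrpN H x : subgrp H -> H x -> H (- x).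
Proof. by move=> [H0 HB] Hx; rewrite -sub0r; apply: HB. Qed.

Lemma subgrpD H x y : subgrp H -> H x -> H y -> H (x + y).
Proof. by move=> sH Hx Hy; rewrite -[y]opprK; apply: sH.2 => //; apply: subgrpN. Qed.

Lemma subgrpNE H x : subgrp H -> H (- x) -> H x.
Proof. by move=> sH /(subgrpN sH); rewrite opprK. Qed.

(** The choice is applied to the coset as a set, so congruent points get equal representatives and
    classes become fibres of a map. *)
Definition coset_rep H (x : V) : V := xget 0 [set y | H (x - y)]%classic.

Lemma coset_repP H x : subgrp H -> H (x - coset_rep H x).
Proof.
move=> [H0 _]; apply: (@xgetPex _ 0 [set y | H (x - y)]%classic).
by exists x => /=; rewrite subrr.
Qed.

Lemma coset_rep_eq H x y : subgrp H -> coset_rep H x = coset_rep H y <-> H (x - y).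
Proof.
move=> sH; split=> [e|Hxy].
  have -> : x - y = (x - coset_rep H x) - (y - coset_rep H y).
    by rewrite e; ring.
  by apply: sH.2; apply: coset_repP.
congr xget; apply/funext => z /=; apply/propext; split=> Hz.
  have -> : y - z = (x - z) - (x - y) by ring.
  exact: sH.2.
have -> : x - z = (x - y) + (y - z) by rewrite addrA subrK.
exact: subgrpD.
Qed.

Definition cosets H Z : {fset V} := [fset coset_rep H x | x in Z].

Lemma cosetsS H A B : A `<=` B -> (#|` cosets H A| <= #|` cosets H B|)%N.
Proof.
by move=> /fsubsetP AB; apply/fsubset_leq_card/subset_imfset => x /AB.
Qed.

Definition zmultiple (w x : V) := exists k : int, x = w *~ k.

Lemma subgrp_zmultiple w : subgrp (zmultiple w).
Proof.
split; first by exists 0; rewrite mulr0z.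
by move=> _ _ [k ->] [l ->]; exists (k - l); rewrite mulrzBr.
Qed.

End Cosets.

(** * Long progressions in iterated sums of a set of small doubling *)

Section LongProgressions.
Variable V : comNzRingType.
Implicit Types (A B H X Z : {fset V}).

Definition progr (w : V) T : {fset V} := [fset w *+ t | t in iota 0 T].

Lemma progrP w T x :
  reflect (exists2 t, (t < T)%N & x = w *+ t) (x \in progr w T).
Proof.
by apply: (iffP (imfsetP _ _ _ _)) => /= -[t]; rewrite ?mem_iota => tT ->; exists t;
  rewrite ?mem_iota.
Qed.

Lemma card_progr w T : (#|` progr w T| <= T)%N.
Proof.
by apply: leq_trans (leq_imfset_card _ _ _) _; rewrite /= undup_id ?iota_uniq// size_iota.
Qed.

(** A generalised arithmetic progression with all sides of length [T]; its size is polynomial in [T]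
    once the number of generators is bounded. *)
Fixpoint gbox (s : seq V) T : {fset V} :=
  if s is x :: s' then addf (progr x T) (gbox s' T) else [fset 0].

Lemma card_gbox s T : (#|` gbox s T| <= T ^ size s)%N.
Proof.
elim: s => [|x s IHs] /=; first by rewrite cardfs1.
by rewrite (leq_trans (leq_card_addf _ _)) // expnS leq_mul // card_progr.
Qed.

Lemma gboxS s T : gbox s T `<=` gbox s T.+1.
Proof.
elim: s => [|x s IHs] //=; apply: addfS => //.
by apply/fsubsetP => _ /progrP[t tT ->]; apply/progrP; exists t => //; apply: ltnW.
Qed.

Lemma gboxD s T x : x \in s -> addf [fset x] (gbox s T) `<=` gbox s T.+1.
Proof.
elim: s => [//|y s IHs]; rewrite inE => /orP[/eqP <-|/IHs sx] /=.
  rewrite addfA; apply: addfS (gboxS _ _).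
  apply/fsubsetP => _ /addfP[_ [_ [/fset1P -> /progrP[t tT ->] ->]]].
  by apply/progrP; exists t.+1; rewrite // mulrS.
rewrite addfA (addfC [fset x]) -addfA; apply: addfS sx.
by apply/fsubsetP => _ /progrP[t tT ->]; apply/progrP; exists t => //; apply: ltnW.
Qed.

(** Each further copy of [H] is absorbed at the price of one element of [X], so a sum of many copies
    of [H] stays inside polynomially many translates of [H]. *)
Lemma mulnf_gbox H X j : mulnf 2 H `<=` addf X H ->
  mulnf j.+1 H `<=` addf (gbox X j.+1) H.
Proof.
move=> HX; elim: j => [|j IHj].
  rewrite mulnf1; apply/fsubsetP => x xH; rewrite -[x]add0r mem_addf //.
  elim: (enum_fset X) => [|y s IHs] /=; first by rewrite inE.
  by rewrite -[0]addr0 mem_addf //; apply/progrP; exists 0.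
rewrite mulnfS; apply: (fsubset_trans (addfS (fsubset_refl _) IHj)).
rewrite addfA (addfC H) -addfA (_ : addf H H = mulnf 2 H); last by rewrite mulnfS mulnf1.
apply: (fsubset_trans (addfS (fsubset_refl _) HX)).
rewrite addfA; apply: addfS => //; apply/fsubsetP => _ /addfP[b [x [bB xX ->]]].
have xX' : x \in enum_fset X by [].
apply: (fsubsetP (gboxD j.+1 xX')).
by rewrite addrC mem_addf // inE.
Qed.

Lemma popular_fiber (T U : choiceType) (f : T -> U) (A : {fset T}) (C : {fset U}) :
  A != fset0 -> {in A, forall x, f x \in C} ->
  exists c, (#|` A| <= #|` C| * #|` [fset x in A | f x == c]|)%N.
Proof.
move=> A0 fC; apply/not_existsP => small.
have lt c : (#|` C| * #|` [fset x in A | f x == c]| < #|` A|)%N.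
  by rewrite ltnNge; apply/negP => /small.
have fA0 : (0 < #|` f @` A|)%N.
  by case/fset0Pn: A0 => a aA; rewrite cardfs_gt0; apply/fset0Pn; exists (f a); rewrite in_imfset.
have leC : (#|` f @` A| <= #|` C|)%N.
  by apply: fsubset_leq_card; apply/fsubsetP => _ /imfsetP[x /= xA ->]; apply: fC.
have : (#|` C| * #|` A| + #|` f @` A| <= #|` f @` A| * #|` A|)%N.
  rewrite [X in (_ * X + _)%N](card_partition f) big_distrr /=.
  rewrite [X in (_ + X)%N]card_fset_sum1 -big_split /=.
  rewrite [X in (_ <= X * _)%N]card_fset_sum1 big_distrl /=.
  by apply: leq_sum => c _; rewrite mul1n addn1.
by have := leq_mul2r #|` A| #|` f @` A| #|` C|; rewrite leC orbT; lia.
Qed.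

(** Pigeonhole on [b - 2 a], with [a] in [A] and [b] in the set of the preceding stage. On a popular
    fibre [2 (a - a') = b - b'], so doubling carries differences of the new set to differences of
    the old one. Each stage loses a factor [N]. *)
Lemma doubling_chain A N J :
  A != fset0 -> (#|` addf A (oppf (mulnf 2 A))| <= N * #|` A|)%N ->
  exists2 B, B `<=` A & (#|` A| <= N ^ J * #|` B|)%N /\
    {in B &, forall a a' j, (j <= J)%N -> (a - a') *+ 2 ^ j \in addf A (oppf A)}.
Proof.
move=> A0 AN; elim: J => [|J [B BA [AB Bd]]].
  exists A => //; split; first by rewrite expn0 mul1n.
  by move=> a a' aA a'A j; rewrite leqn0 => /eqP ->; rewrite expn0 mulr1n mem_addf // mem_oppf opprK.
have A_gt0 : (0 < #|` A|)%N by rewrite cardfs_gt0.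
have B_gt0 : (0 < #|` B|)%N by move: AB; case: #|` B| => //; rewrite muln0 leqNgt A_gt0.
pose f (p : V * V) := p.2 - p.1 *+ 2.
have [||c cP] := @popular_fiber _ _ f (A `*` B) (addf A (oppf (mulnf 2 A))).
- by rewrite -cardfs_gt0 cardfsM muln_gt0 A_gt0.
- move=> [a b]; rewrite in_fsetM /= => /andP[aA bB].
  have a2 : a *+ 2 \in mulnf 2 A by rewrite mulnfS mulnf1 mulr2n mem_addf.
  by apply: mem_addf; [exact: (fsubsetP BA)|rewrite mem_oppf opprK].
pose fib := [fset x in A `*` B | f x == c].
have fibP p : p \in fib = [&& p.1 \in A, p.2 \in B & p.2 - p.1 *+ 2 == c].
  by rewrite !inE /= -andbA.
exists [fset p.1 | p in fib].
  by apply/fsubsetP => x /imfsetP[p /=]; rewrite fibP => /and3P[pA _ _] ->.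
split.
  have -> : #|` [fset p.1 | p in fib]| = #|` fib|.
    apply: card_in_imfset => -[a b] [a' b']; rewrite !fibP /= => /and3P[_ _ /eqP e] /and3P[_ _ /eqP e'] aa'.
    by move: e e'; rewrite aa' => <- /addIr <-.
  move: cP; rewrite cardfsM -/fib => cP.
  have : (#|` A| * #|` B| <= #|` A| * (N * #|` fib|))%N.
    by apply: leq_trans cP _; rewrite mulnA leq_mul2r (mulnC _ N) AN orbT.
  rewrite leq_mul2l eqn0Ngt A_gt0 /= => BN.
  by apply: leq_trans AB _; rewrite expnSr -mulnA leq_mul2l BN orbT.
move=> x y /imfsetP[[a b] /=]; rewrite fibP /= => /and3P[aA bB /eqP e] -> {x}.
move=> /imfsetP[[a' b'] /=]; rewrite fibP /= => /and3P[a'A b'B /eqP e'] -> {y} [_|j jJ].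
  by rewrite expn0 mulr1n mem_addf // mem_oppf opprK.
rewrite expnS mulrnA mulrnBl.
have -> : a *+ 2 - a' *+ 2 = b - b'.
  have -> : b = c + a *+ 2 by rewrite -e; ring.
  have -> : b' = c + a' *+ 2 by rewrite -e'; ring.
  ring.
exact: Bd.
Qed.

(** Binary expansion: each of the [J] digits uses one copy of [H], a zero digit using [0]. *)
Lemma progr_mulnf H z J : (forall j, (j < J)%N -> z *+ 2 ^ j \in H) -> 0 \in H ->
  progr z (2 ^ J) `<=` mulnf J H.
Proof.
move=> zH H0; apply/fsubsetP => _ /progrP[t tJ ->].
elim: J zH t tJ => [|J IHJ] zH t.
  by rewrite expn0 ltnS leqn0 => /eqP ->; rewrite mulr0n inE.
have {}IHJ := IHJ (fun j jJ => zH j (ltnW jJ)).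
have [tJ _|tJ tJ'] := ltnP t (2 ^ J).
  by rewrite mulnfS -[_ *+ _]add0r mem_addf // IHJ.
rewrite mulnfS -(subnKC tJ) mulrnDr mem_addf ?zH // IHJ //.
by move: tJ'; rewrite expnS; lia.
Qed.

End LongProgressions.

(** One point of [Z] per coset, pushed along the progression, gives [T] distinct points on that
    coset. A long progression with a small sumset thus forces few cosets. *)
Lemma lines_progr (R : realType) (w : R) (Z : {fset R}) T : w != 0 ->
  (T * #|` cosets (zmultiple w) Z| <= #|` addf Z (progr w T)|)%N.
Proof.
move=> w0; have sw := subgrp_zmultiple w.
have /choice[r rP] : forall c : R, exists x, c \in cosets (zmultiple w) Z ->
    x \in Z /\ coset_rep (zmultiple w) x = c.
  move=> c; have [/imfsetP[x /= xZ ->]|] := boolP (c \in cosets (zmultiple w) Z); last by exists 0.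
  by exists x.
have cI : #|` [fset t in iota 0 T]| = T.
  by rewrite card_fseq undup_id ?iota_uniq // size_iota.
rewrite mulnC -[X in (_ * X <= _)%N]cI -cardfsM.
apply: (@leq_card_inj _ _ (fun p => r p.1 + w *+ p.2)).
  move=> [c t] [c' t']; rewrite !in_fsetM /= => /andP[cZ _] /andP[c'Z _] e.
  have [_ rc] := rP _ cZ; have [_ rc'] := rP _ c'Z.
  have cc' : c = c'.
    rewrite -rc -rc'; apply/(coset_rep_eq _ _ sw); exists (t'%:Z - t%:Z).
    by rewrite mulrzBr -!pmulrn; apply/eqP; rewrite subr_eq addrAC eq_sym subr_eq addrC -e addrC.
  move: e; rewrite cc' -!(mulr_natr w) => /addrI/(mulfI w0)/eqP.
  by rewrite eqr_nat => /eqP ->.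
move=> [c t]; rewrite in_fsetM !inE /= mem_iota /= => /andP[/rP[rZ _] tT].
by rewrite mem_addf //; apply/progrP; exists t.
Qed.

(** * Dilates of a set with small [A + lam A], and covering by few lines *)

Section Dilates.
Variable R : realType.
Implicit Types (A B S X Y Z : {fset R}) (lam K m : R).
Local Notation card A := (#|` A|%:R : R).

Definition dilf lam A : {fset R} := [fset lam * a | a in A].

Lemma dilfP lam A x : reflect (exists2 a, a \in A & x = lam * a) (x \in dilf lam A).
Proof. exact: imfsetP. Qed.

Lemma mem_dilf lam A a : a \in A -> lam * a \in dilf lam A.
Proof. by move=> aA; apply/dilfP; exists a. Qed.

Lemma card_dilf lam A : lam != 0 -> #|` dilf lam A| = #|` A|.
Proof. by move=> l0; rewrite card_imfset //; apply: mulfI. Qed.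

Lemma leq_card_dilf lam A : (#|` dilf lam A| <= #|` A|)%N.
Proof. exact: leq_imfset_card. Qed.

Lemma dilfS lam A B : A `<=` B -> dilf lam A `<=` dilf lam B.
Proof. by move=> /fsubsetP AB; apply/subset_imfset => x /AB. Qed.

Lemma dilfD lam A B : dilf lam (addf A B) = addf (dilf lam A) (dilf lam B).
Proof.
apply/fsetP => x; apply/dilfP/addfP.
  move=> [_ /addfP[a [b [aA bB ->]]] ->].
  by exists (lam * a), (lam * b); rewrite !mem_dilf // mulrDr.
move=> [_ [_ [/dilfP[a aA ->] /dilfP[b bB ->] ->]]].
by exists (a + b); rewrite ?mem_addf // mulrDr.
Qed.

Lemma dilf_opp lam A : dilf lam (oppf A) = oppf (dilf lam A).
Proof.
apply/fsetP => x; rewrite mem_oppf; apply/dilfP/dilfP => -[a aA e].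
  by exists (- a); rewrite -?mem_oppf // e mulrN.
by exists (- a); rewrite ?mem_oppf ?opprK // mulrN -e opprK.
Qed.

Lemma dilf_mulnf lam k A : dilf lam (mulnf k A) = mulnf k (dilf lam A).
Proof.
elim: k => [|k IHk]; last by rewrite !mulnfS dilfD IHk.
by rewrite !mulnf0 /dilf imfset_fset1 mulr0.
Qed.

Lemma dilf_dilf lam mu A : dilf lam (dilf mu A) = dilf (lam * mu) A.
Proof.
apply/fsetP => x; apply/dilfP/dilfP => [[_ /dilfP[a aA ->] ->]|[a aA ->]].
  by exists a; rewrite ?mulrA.
by exists (mu * a); rewrite ?mem_dilf // mulrA.
Qed.

Lemma dilf1 A : dilf 1 A = A.
Proof.
apply/fsetP => x; apply/dilfP/idP => [[a aA ->]|xA]; first by rewrite mul1r.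
by exists x; rewrite ?mul1r.
Qed.

Lemma dilf_progr lam z T : dilf lam (progr z T) = progr (lam * z) T.
Proof.
apply/fsetP => x; apply/dilfP/progrP => [[_ /progrP[t tT ->] ->]|[t tT ->]].
  by exists t; rewrite ?mulrnAr.
by exists (z *+ t); rewrite ?mulrnAr //; apply/progrP; exists t.
Qed.

Definition small_dilate_sum lam K A :=
  A != fset0 /\ card (addf A (dilf lam A)) <= K * card A.

(** Unlike a bound on the size of [S], covering by [m] translates of [eA - eA] is stable under sums,
    negation and dilation by [lam], with [m] and [e] controlled uniformly in [A]. *)
Definition covered A m e S := exists2 Y, card Y <= m &
  S `<=` addf Y (addf (mulnf e A) (oppf (mulnf e A))).

Lemma card_mulnf_diff lam K A k l : lam != 0 -> 0 <= K -> small_dilate_sum lam K A ->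
  card (addf (mulnf k A) (oppf (mulnf l A))) <= K ^+ (k + l) * card A.
Proof.
move=> l0 K0 [A0 AK]; rewrite -(card_dilf A l0); apply: plunnecke => //.
  by rewrite -cardfs_gt0 card_dilf // cardfs_gt0.
by rewrite addfC card_dilf.
Qed.

Lemma covered_card lam K A m e S : lam != 0 -> 0 <= K -> small_dilate_sum lam K A ->
  covered A m e S -> card S <= m * K ^+ (e + e) * card A.
Proof.
move=> l0 K0 hA [Y Ym SY].
apply: (@le_trans _ _ (card Y * card (addf (mulnf e A) (oppf (mulnf e A))))).
  by rewrite -natrM ler_nat (leq_trans (fsubset_leq_card SY)) // leq_card_addf.
by rewrite -mulrA ler_pM // (card_mulnf_diff _ _ l0).
Qed.

Lemma covered_self A : A != fset0 -> covered A 1 1 A.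
Proof.
case/fset0Pn => a aA; exists [fset a]; first by rewrite cardfs1.
apply/fsubsetP => x xA; rewrite mulnf1 -[x](subrKC a) mem_addf ?inE // mem_addf //.
by rewrite mem_oppf opprK.
Qed.

Lemma coveredD A m m' e e' S S' : covered A m e S -> covered A m' e' S' ->
  covered A (m * m') (e + e') (addf S S').
Proof.
move=> [Y Ym SY] [Y' Ym' SY']; exists (addf Y Y').
  apply: (@le_trans _ _ (card Y * card Y')); last by rewrite ler_pM.
  by rewrite -natrM ler_nat leq_card_addf.
apply: (fsubset_trans (addfS SY SY')).
by rewrite !mulnfD oppfD addfACA (addfACA (mulnf e A)).
Qed.

Lemma coveredN A m e S : covered A m e S -> covered A m e (oppf S).
Proof.
move=> [Y Ym SY]; exists (oppf Y); first by rewrite card_oppf.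
apply: (fsubset_trans (oppfS SY)).
by rewrite !oppfD oppfK (addfC (oppf _) (mulnf _ _)).
Qed.

(** By Ruzsa covering [lam A] lies in [X + A - A] with [|X| <= K]. Hence [lam (eA - eA)] lies in
    [eX - eX] plus [2eA - 2eA], and [eX] has at most [K^e] elements. *)
Lemma covered_dilf lam K A m e S : lam != 0 -> 0 <= K -> small_dilate_sum lam K A ->
  covered A m e S -> covered A (m * (K ^+ e * K ^+ e)) (e + e) (dilf lam S).
Proof.
move=> l0 K0 [A0 AK] [Y Ym SY].
have [X [_ XK lX]] := ruzsa_covering A0 AK.
have mulX : mulnf e (dilf lam A) `<=` addf (mulnf e X) (addf (mulnf e A) (oppf (mulnf e A))).
  by apply: (fsubset_trans (mulnfSr e lX)); rewrite !mulnfDr oppf_mulnf.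
have cX : card (mulnf e X) <= K ^+ e.
  apply: (@le_trans _ _ (card X ^+ e)); first by rewrite -natrX ler_nat card_mulnf.
  by rewrite lerXn2r // nnegrE.
exists (addf (dilf lam Y) (addf (mulnf e X) (oppf (mulnf e X)))).
  apply: (@le_trans _ _ (card Y * (card (mulnf e X) * card (mulnf e X)))).
    rewrite -!natrM ler_nat (leq_trans (leq_card_addf _ _)) // leq_mul ?leq_card_dilf //.
    by rewrite (leq_trans (leq_card_addf _ _)) // card_oppf.
  by rewrite ler_pM ?mulr_ge0 // ler_pM.
apply: (fsubset_trans (dilfS lam SY)); rewrite dilfD -addfA; apply: addfS => //.
rewrite dilfD dilf_opp dilf_mulnf.
apply: (fsubset_trans (addfS mulX (oppfS mulX))).
rewrite !oppfD oppfK addfACA (addfC (oppf (mulnf e A)) (mulnf e A)).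
by rewrite !mulnfD oppfD (addfACA (mulnf e A) (mulnf e A)).
Qed.

Lemma covered_pow lam K i : lam != 0 -> 0 <= K -> exists m e, forall A,
  small_dilate_sum lam K A -> covered A m e (dilf (lam ^+ i) A).
Proof.
move=> l0 K0; elim: i => [|i [m [e IHi]]].
  by exists 1, 1%N => A [A0 _]; rewrite expr0 dilf1; apply: covered_self.
exists (m * (K ^+ e * K ^+ e)), (e + e)%N => A hA.
rewrite exprS -dilf_dilf; apply: (covered_dilf l0) => //; exact: IHi.
Qed.

Lemma le_finite_family (T : Type) (P : T -> Prop) (f : nat -> T -> R) (g : T -> R) d :
  (forall x, P x -> 0 <= g x) ->
  (forall i, exists M, forall x, P x -> f i x <= M * g x) ->
  exists2 M, 0 <= M & forall i x, (i < d)%N -> P x -> f i x <= M * g x.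
Proof.
move=> g0 fM; elim: d => [|d [M M0 IHd]]; first by exists 0.
have [M' M'P] := fM d; exists (M + `|M'|); first by rewrite addr_ge0.
move=> i x; rewrite ltnS leq_eqVlt => /orP[/eqP -> Px|id Px].
  rewrite (le_trans (M'P _ Px)) // ler_wpM2r ?g0 //.
  by rewrite (le_trans (ler_norm _)) // lerDr.
by rewrite (le_trans (IHd _ _ id Px)) // ler_wpM2r ?g0 // lerDl.
Qed.

(** As [n <= N^x], the factor [2^-x] is at most a negative power of [n]. Half of the exponent,
    [kap = ln 2 / 2] per unit of [x], is kept for that power, and the other half absorbs [x^a]. *)
Lemma poly_exp_decay (a N : nat) : (1 < N)%N -> exists C s : R,
  [/\ 0 < C, 0 < s, s < 1 & forall x n : nat, (0 < n)%N -> (n <= N ^ x)%N ->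
    x%:R ^+ a / 2 ^+ x <= C * n%:R `^ (- s)].
Proof.
move=> N1; have lnN : 0 < ln N%:R :> R by rewrite ln_gt0 // ltr1n.
have ln2_gt0 : 0 < ln 2 :> R by rewrite ln_gt0 // ltr1n.
have ln2N : ln 2 <= ln N%:R :> R by rewrite ler_ln ?posrE ?ltr0n ?ler_nat // ltnW.
pose b : R := a.+1%:R; have b0 : 0 < b by rewrite ltr0n.
pose kap : R := ln 2 / 2; have kap0 : 0 < kap by rewrite divr_gt0.
exists ((1 + b / kap) ^+ a), (kap / ln N%:R); split.
- by rewrite exprn_gt0 // addr_gt0 // divr_gt0.
- by rewrite divr_gt0.
- by rewrite ltr_pdivrMr // mul1r (lt_le_trans _ ln2N) // /kap; lra.
move=> x n n0 nN.
have nN' : N%:R `^ (x%:R * - (kap / ln N%:R)) <= n%:R `^ (- (kap / ln N%:R)) :> R.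
  rewrite powRrM powR_mulrn ?ler0n // -natrX.
  rewrite !powRN lef_pV2 ?posrE ?powR_gt0 ?ltr0n ?expn_gt0 ?(ltnW N1) //.
  by rewrite ge0_ler_powR ?nnegrE ?ler0n ?ler_nat // divr_ge0 // ltW.
have C0 : 0 <= (1 + b / kap) ^+ a by rewrite exprn_ge0 // addr_ge0 // divr_ge0 // ltW.
apply: le_trans (ler_wpM2l C0 nN').
have -> : N%:R `^ (x%:R * - (kap / ln N%:R)) = expR (- (kap * x%:R)).
  rewrite /powR pnatr_eq0 eqn0Ngt (ltnW N1) /=; congr expR.
  by field; rewrite gt_eqF.
have -> : 2 ^- x = expR (- (kap * x%:R)) * expR (- (kap * x%:R)) :> R.
  rewrite -expRD -[in LHS](@lnK _ 2) ?posrE // -expRM_natl -expRN; congr expR.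
  by rewrite /kap; field.
rewrite mulrA ler_wpM2r ?expR_ge0 // expRN ler_pdivrMr ?expR_gt0 //.
have [->|a0] := posnP a; first by rewrite !expr0 mul1r -[leLHS]expR0 ler_expR mulr_ge0 // ltW.
have -> : expR (kap * x%:R) = expR (kap * x%:R / a%:R) ^+ a.
  by rewrite -expRM_natl; congr expR; field; rewrite pnatr_eq0 -lt0n.
have c1 : 0 <= 1 + b / kap by rewrite addr_ge0 // divr_ge0 // ltW.
rewrite -exprMn lerXn2r ?nnegrE ?mulr_ge0 ?expR_ge0 //.
have e1 := expR_ge1Dx (kap * x%:R / a%:R).
have x0 : 0 <= x%:R :> R by [].
apply: (@le_trans _ _ ((b / kap) * (kap * x%:R / a%:R))).
  have -> : b / kap * (kap * x%:R / a%:R) = x%:R * (b / a%:R).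
    by field; rewrite pnatr_eq0 -lt0n a0 gt_eqF.
  rewrite ler_peMr // ler_pdivlMr ?ltr0n // mul1r ler_nat //.
have bk : 0 <= b / kap by rewrite divr_ge0 ?ltW.
have y0 : 0 <= kap * x%:R / a%:R by rewrite divr_ge0 // mulr_ge0 // ltW.
by rewrite ler_pM // ?lerDr //; lra.
Qed.

(** A difference [z] of two points at the end of a doubling chain of length about [log n] generates
    a progression of length a power of [n] inside a sum of [J.+1] copies of [A - A]. Its dilate by
    [lam^i] lies in polynomially many (in [J]) translates of [lam^i (A - A)], so adding it to
    [A + lam A] gives [O(n)] points up to that factor, whereas every coset contributes the length of
    the progression. *)
Lemma few_lines lam K d : lam != 0 -> 0 <= K -> exists C s, [/\ 0 < C, 0 < s, s < 1 &
  forall A, small_dilate_sum lam K A -> exists2 z, z != 0 & forall i, (i < d)%N ->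
    card (cosets (zmultiple (lam ^+ i * z)) (addf A (dilf lam A)))
      <= C * card A `^ (1 - s)].
Proof.
move=> l0 K0.
have [M1 M10 M1P] : exists2 M, 0 <= M & forall A, small_dilate_sum lam K A ->
    card (addf A (mulnf 2 (addf A (oppf A)))) <= M * card A.
  exists (K ^+ (3 + 2)); first by rewrite exprn_ge0.
  move=> A hA; rewrite mulnfDr -oppf_mulnf addfA -mulnfS.
  exact: (card_mulnf_diff _ _ l0).
have [M2 M20 M2P] : exists2 M, 0 <= M & forall i A, (i < d)%N -> small_dilate_sum lam K A ->
    card (addf (addf A (dilf lam A)) (dilf (lam ^+ i) (addf A (oppf A)))) <= M * card A.
  apply: le_finite_family => // i.
  have [m [e mP]] := covered_pow i l0 K0.
  exists ((1 * (1 * (K ^+ 1 * K ^+ 1)) * (m * m)) * K ^+ (1 + (1 + 1) + (e + e) + (1 + (1 + 1) + (e + e)))).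
  move=> A hA; apply: (covered_card l0) => //.
  rewrite dilfD dilf_opp; apply: coveredD; apply: coveredD.
  - by apply: covered_self; case: hA.
  - by apply: (covered_dilf l0) => //; apply: covered_self; case: hA.
  - exact: mP.
  - by apply: coveredN; apply: mP.
have [N N1 NP] : exists2 N, (1 < N)%N & K ^+ 3 <= N%:R.
  exists (Num.bound (K ^+ 3)).+2 => //.
  have /ltW h := archi_boundP (exprn_ge0 3 K0); apply: (le_trans h).
  by rewrite ler_nat ltnW.
(* Bounds the number of generators of the box uniformly in [A], so the polynomial loss in [J] has
   fixed degree. *)
pose a := Num.bound M1.
have [C [s [C0 s0 s1 CsP]]] := @poly_exp_decay a N N1.
exists (M2 * C + K + 1), s; split=> //; first by rewrite ltr_wpDl // addr_ge0 // mulr_ge0 // ltW.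
move=> A hA; have [A0 AK] := hA; pose n := #|` A|.
have n0 : (0 < n)%N by rewrite cardfs_gt0.
have n0R : 0 < n%:R :> R by rewrite ltr0n.
have [n1|n1] := leqP n 1.
  exists 1; first exact: oner_neq0.
  move=> i _; have -> : #|` A| = 1%N by apply/eqP; rewrite -/n eqn_leq n1.
  rewrite powR1 mulr1; apply: (@le_trans _ _ (card (addf A (dilf lam A)))).
    by rewrite ler_nat leq_imfset_card.
  have AK1 : card (addf A (dilf lam A)) <= K.
    by move: AK; rewrite (_ : #|` A| = 1%N) ?mulr1 //; apply/eqP; rewrite -/n eqn_leq n1.
  by rewrite (le_trans AK1) //; have := mulr_ge0 M20 (ltW C0); lra.
(* The first bound leaves two points in [B], the second makes [2 ^ J.+1] at least a power of [n].
   The chain controls the exponents [0] to [J], hence [J.+1] binary digits. *)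
have [J NJ nJ] : exists2 J, (N ^ J < n)%N & (n <= N ^ J.+1)%N.
  have n'0 : (0 < n.-1)%N by rewrite -ltnS prednK.
  exists (trunc_log N n.-1).
    by rewrite (leq_ltn_trans (trunc_logP N1 n'0)) // ltn_predL.
  by rewrite -{1}(prednK n0) trunc_log_ltn.
have AN : (#|` addf A (oppf (mulnf 2 A))| <= N * #|` A|)%N.
  rewrite -(ler_nat R) natrM; have := card_mulnf_diff 1 2 l0 K0 hA; rewrite mulnf1 => h.
  by rewrite (le_trans h) // ler_wpM2r.
have [B BA [AB Bd]] := doubling_chain J A0 AN.
have B1 : (1 < #|` B|)%N.
  rewrite ltnNge; apply/negP => B1; move: NJ; rewrite ltnNge => /negP; apply.
  by rewrite (leq_trans AB) // -[leqRHS]muln1 leq_mul2l B1 orbT.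
have [x xB] : exists x, x \in B by apply/fset0Pn; rewrite -cardfs_gt0 ltnW.
have [y yBx] : exists y, y \in B `\ x.
  by apply/fset0Pn; rewrite -cardfs_gt0; move: B1; rewrite (cardfsD1 x) xB.
move: yBx; rewrite !inE => /andP[yx yB].
pose z := x - y; have z0 : z != 0 by rewrite subr_eq0 eq_sym.
exists z => // i id; pose w := lam ^+ i * z.
have w0 : w != 0 by rewrite mulf_neq0 // expf_neq0.
pose H := addf A (oppf A); pose Z := addf A (dilf lam A).
have H0 : 0 \in H.
  by case/fset0Pn: A0 => b bA; rewrite -(subrr b) mem_addf // mem_oppf opprK.
have zH : progr z (2 ^ J.+1) `<=` mulnf J.+1 H.
  by apply: progr_mulnf => // j jJ; apply: Bd.
have [X [_ XM HX]] := ruzsa_covering A0 (M1P A hA).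
have wH : progr w (2 ^ J.+1) `<=` addf (dilf (lam ^+ i) (gbox X J.+1)) (dilf (lam ^+ i) H).
  rewrite -dilf_progr -dilfD; apply: dilfS; apply: (fsubset_trans zH).
  exact: mulnf_gbox.
have Xa : (#|` X| <= a)%N.
  by rewrite ltnW // -(ltr_nat R) (le_lt_trans XM) // archi_boundP.
have L1 : 2 ^+ J.+1 * card (cosets (zmultiple w) Z) <= J.+1%:R ^+ a * (M2 * n%:R).
  rewrite -natrX -natrM; apply: (@le_trans _ _ (card (addf Z (progr w (2 ^ J.+1))))).
    by rewrite ler_nat lines_progr.
  apply: (@le_trans _ _ (card (addf (dilf (lam ^+ i) (gbox X J.+1)) (addf Z (dilf (lam ^+ i) H))))).
    rewrite ler_nat; apply: fsubset_leq_card; rewrite addfA (addfC _ Z) -addfA.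
    exact: addfS.
  apply: (@le_trans _ _ (J.+1%:R ^+ a * card (addf Z (dilf (lam ^+ i) H)))).
    rewrite -natrX -natrM ler_nat (leq_trans (leq_card_addf _ _)) // leq_mul //.
    rewrite (leq_trans (leq_card_dilf _ _)) // (leq_trans (card_gbox _ _)) //.
    by rewrite leq_pexp2l.
  by rewrite ler_wpM2l ?exprn_ge0 // M2P.
rewrite -/Z -/w; move: L1; rewrite mulrC -ler_pdivlMr ?exprn_gt0 // => L1.
rewrite (le_trans L1) // mulrAC.
have := CsP J.+1 n n0 nJ => h.
apply: (@le_trans _ _ ((C * n%:R `^ (- s)) * (M2 * n%:R))).
  by rewrite ler_wpM2r // mulr_ge0.
have -> : card A `^ (1 - s) = n%:R * n%:R `^ (- s).
  by rewrite powRD ?powRr1 // ?(gt_eqF n0R) // implybT.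
have -> : C * n%:R `^ (- s) * (M2 * n%:R) = (M2 * C) * (n%:R * n%:R `^ (- s)) by ring.
rewrite ler_wpM2r ?mulr_ge0 ?powR_ge0 // -addrA lerDl addr_ge0 //.
Qed.
End Dilates.

(** * The Brunn-Minkowski function *)

Section BrunnMinkowskiFunction.
Variable R : realType.
Implicit Types (d : nat) (x y h t M N : R).

(** The Brunn-Minkowski lower bound for the volume of a sum in dimension [d]. The constant [c] of
    the theorem is its value at [|a_d|] and [|a_0|]. *)
Definition bm d x y : R := (x `^ d%:R^-1 + y `^ d%:R^-1) ^+ d.

Lemma bmC d x y : bm d x y = bm d y x. Proof. by rewrite /bm addrC. Qed.

Lemma bm_ge0 d x y : 0 <= bm d x y.
Proof. by rewrite exprn_ge0 // addr_ge0 ?powR_ge0. Qed.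

Lemma bm_gt0 d x y : 0 < x -> 0 < bm d x y.
Proof. by move=> x0; rewrite exprn_gt0 // ltr_wpDr ?powR_ge0 // powR_gt0. Qed.

Lemma powR_rootK d x : (0 < d)%N -> 0 <= x -> (x `^ d%:R^-1) ^+ d = x.
Proof.
move=> d0 x0; rewrite -powR_mulrn ?powR_ge0 // -powRrM mulVf ?powRr1 //.
by rewrite pnatr_eq0 -lt0n.
Qed.

Lemma le_bm d x x' y y' : 0 <= x -> x <= x' -> 0 <= y -> y <= y' ->
  bm d x y <= bm d x' y'.
Proof.
move=> x0 xx' y0 yy'; rewrite /bm lerXn2r ?nnegrE ?addr_ge0 ?powR_ge0 //.
by apply: lerD; rewrite ge0_ler_powR ?nnegrE ?invr_ge0 // (le_trans _ xx', le_trans _ yy').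
Qed.

Lemma bmZ d t x y : (0 < d)%N -> 0 <= t -> 0 <= x -> 0 <= y ->
  bm d (t * x) (t * y) = t * bm d x y.
Proof.
by move=> d0 t0 x0 y0; rewrite /bm !powRM // -mulrDr exprMn powR_rootK.
Qed.

(** Homogeneity, weakened to include [d = 0], where [bm] is constantly 1. *)
Lemma bm_minZ d t x y : 0 <= t <= 1 -> 0 <= x -> 0 <= y ->
  t * bm d x y <= bm d (t * x) (t * y).
Proof.
move=> /andP[t0 t1] x0 y0; have [->|d0] := posnP d; first by rewrite /bm !expr0 mulr1.
by rewrite bmZ.
Qed.

(** Factor a difference of [d]-th powers: shifting both bases by the same [a >= 0] keeps their
    difference and increases every term of the cofactor. *)
Lemma bm_addr d x y h : (0 < d)%N -> 0 <= x -> 0 <= y -> 0 <= h ->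
  bm d x y + h <= bm d x (y + h).
Proof.
move=> d0 x0 y0 h0; rewrite -lerBrDl /bm.
have hE : h = ((y + h) `^ d%:R^-1) ^+ d - (y `^ d%:R^-1) ^+ d.
  by rewrite !powR_rootK ?addr_ge0 //; ring.
have yh : y `^ d%:R^-1 <= (y + h) `^ d%:R^-1.
  by rewrite ge0_ler_powR ?nnegrE ?invr_ge0 ?addr_ge0 // lerDl.
rewrite [leLHS]hE; move: (powR_ge0 x d%:R^-1) (powR_ge0 y d%:R^-1) yh {hE}.
move: (x `^ d%:R^-1) (y `^ d%:R^-1) ((y + h) `^ d%:R^-1) => a t t' a0 t0 tt'.
have t'0 := le_trans t0 tt'.
rewrite !subrXX (_ : a + t' - (a + t) = t' - t); last by ring.
rewrite ler_wpM2l ?subr_ge0 //; apply: ler_sum => i _.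
rewrite ler_pM ?exprn_ge0 // lerXn2r ?nnegrE ?addr_ge0 // lerDr //.
Qed.

(** Hoelder with exponents [(k+1)/k] and [k+1] applied to [x = M (x / M)] and [y = N (y / N)]. It
    raises the dimension by one, [M] and [N] being the largest sections. For [k = 0] sections are
    single points. *)
Lemma bm_step k x y M N : 0 < M -> 0 < N -> 0 <= x -> 0 <= y ->
  (k = 0%N -> M = 1 /\ N = 1) ->
  bm k.+1 x y <= bm k M N * (x / M + y / N).
Proof.
move=> M0 N0 x0 y0; case: (posnP k) => [-> /(_ erefl)[-> ->]|k0 _].
  by rewrite /bm expr0 mul1r !divr1 expr1 invr1 !powRr1.
have k0' : 0 < k%:R :> R by rewrite ltr0n.
have k1 : 0 < k.+1%:R :> R by rewrite ltr0n.
have [kn k1n] : k%:R != 0 :> R /\ k.+1%:R != 0 :> R by split; rewrite gt_eqF.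
have k2n : k%:R + 1 != 0 :> R by rewrite natr1.
have k3n : 1 + k%:R != 0 :> R by rewrite nat1r.
pose r : R := k.+1%:R^-1.
have xM z L : 0 <= z -> 0 < L -> z `^ r = L `^ r * (z / L) `^ r.
  move=> z0 L0; rewrite -powRM; [|exact: ltW|by rewrite divr_ge0 // ltW].
  by rewrite mulrC divfK // gt_eqF.
have pos z L : 0 <= z -> 0 < L -> 0 <= z / L by move=> z0 L0; rewrite divr_ge0 // ltW.
have MN0 : 0 <= x / M + y / N by rewrite addr_ge0 ?pos.
have := @hoelder2 R (M `^ r) (N `^ r) ((x / M) `^ r) ((y / N) `^ r) (k.+1%:R / k%:R) k.+1%:R.
rewrite !powR_ge0 divr_gt0 // => /(_ isT isT isT isT isT k1).
have -> : (k.+1%:R / k%:R)^-1 + k.+1%:R^-1 = 1 :> R.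
  by rewrite -[in LHS]natr1; field; rewrite ?kn ?k1n ?k2n ?k3n.
move=> /(_ erefl); rewrite -!xM // -!powRrM.
have -> : r * (k.+1%:R / k%:R) = k%:R^-1 by rewrite /r; field; rewrite ?kn ?k1n ?k2n ?k3n.
rewrite /r mulVf // !powRr1 ?pos // => H.
rewrite /bm; apply: (le_trans (lerXn2r k.+1 _ _ H)).
- by rewrite nnegrE addr_ge0 ?powR_ge0.
- by rewrite nnegrE mulr_ge0 ?powR_ge0.
rewrite exprMn (powR_rootK (ltn0Sn k) MN0); apply: ler_wpM2r => //.
set u := _ + _; have u0 : 0 <= u by rewrite addr_ge0 ?powR_ge0.
rewrite -(powR_mulrn k.+1 (powR_ge0 _ _)) -powRrM.
rewrite (_ : _ * k.+1%:R = k%:R); last by field; rewrite ?kn ?k1n ?k2n ?k3n.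
by rewrite powR_mulrn.
Qed.

End BrunnMinkowskiFunction.

(** * Sums of finite sets of integers, with weights *)

Lemma fset_argmax (T : choiceType) (R : realDomainType) (f : T -> R) (S : {fset T}) :
  S != fset0 -> exists2 s, s \in S & {in S, forall x, f x <= f s}.
Proof.
elim/fset1U_rect: S => [|x S xS IHS _]; first by rewrite eqxx.
have [->|/IHS[s sS sP]] := eqVneq (S : {fset T}) fset0.
  by exists x; rewrite ?in_fset1U ?eqxx // => y; rewrite in_fset1U inE orbF => /eqP ->.
have [le|/ltW lt] := leP (f x) (f s).
  by exists s; rewrite ?in_fset1U ?sS ?orbT // => y; rewrite in_fset1U => /orP[/eqP -> //|/sP].
exists x; rewrite ?in_fset1U ?eqxx // => y; rewrite in_fset1U => /orP[/eqP -> //|/sP h].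
exact: le_trans h lt.
Qed.

(** With [s] the maximum of [S] and [t] the minimum of [T], the translates [S + t] and [s + T] lie
    in the sumset and meet only in [s + t]. *)
Lemma card_addf_int (S T : {fset int}) : S != fset0 -> T != fset0 ->
  (#|` S| + #|` T| <= #|` addf S T|.+1)%N.
Proof.
move=> S0 T0; have [s sS sP] := fset_argmax id S0.
have [t tT tP] := fset_argmax -%R T0.
pose A := [fset x + t | x in S]; pose B := [fset s + y | y in T].
have cA : #|` A| = #|` S| by rewrite card_imfset //; apply: addIr.
have cB : #|` B| = #|` T| by rewrite card_imfset //; apply: addrI.
rewrite -cA -cB -cardfsUI -addn1 leq_add //.
  apply: fsubset_leq_card; apply/fsubsetP => x; rewrite in_fsetU.
  by case/orP => /imfsetP[y /= yS ->]; rewrite mem_addf.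
rewrite -(cardfs1 (s + t)); apply: fsubset_leq_card; apply/fsubsetP => x.
rewrite in_fsetI => /andP[/imfsetP[a /= aS ->] /imfsetP[b /= bT e]].
rewrite inE; have := sP _ aS; have := tP _ bT; move: e; rewrite /=; lia.
Qed.

(* The sections of a sumset satisfy [h (s + t) >= min (f s) (g t)] after
   normalisation; subtracting the smallest value peels off a layer, to which the
   one-dimensional bound applies. *)
Lemma sum_sections (R : realType) (S T : {fset int}) (f g h : int -> R) (mu : R) :
  S != fset0 -> T != fset0 ->
  {in S, forall s, 0 < f s <= mu} -> {in T, forall t, 0 < g t <= mu} ->
  (exists2 s, s \in S & f s = mu) -> (exists2 t, t \in T & g t = mu) ->
  (forall s t, s \in S -> t \in T -> Num.min (f s) (g t) <= h (s + t)) ->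
  \sum_(s <- S) f s + \sum_(t <- T) g t - mu <= \sum_(u <- addf S T) h u.
Proof.
have [n] := ubnP (#|` S| + #|` T|)%N.
elim: n S T f g h mu => // n IHn S T f g h mu; rewrite ltnS => STn S0 T0 fS gT.
move=> [s1 s1S fs1] [t1 t1T gt1] hP.
have [s0 s0S s0P] := fset_argmax (fun s => - f s) S0.
have [t0 t0T t0P] := fset_argmax (fun s => - g s) T0.
pose m := Num.min (f s0) (g t0).
have m0 : 0 < m by rewrite lt_min; case/andP: (fS _ s0S) => -> _; case/andP: (gT _ t0T) => -> _.
have mf s : s \in S -> m <= f s by move=> sS; rewrite ge_min; have := s0P _ sS; rewrite lerN2 => ->.
have mg t : t \in T -> m <= g t by move=> tT; rewrite ge_min; have := t0P _ tT; rewrite lerN2 => ->; rewrite orbT.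
have mh u : u \in addf S T -> m <= h u.
  move=> /addfP[s [t [sS tT ->]]]; apply: le_trans (hP _ _ sS tT).
  by rewrite le_min mf // mg.
have cST : m * (#|` S|%:R + #|` T|%:R - 1) <= m * #|` addf S T|%:R.
  rewrite ler_pM2l // lerBlDr -natrD natr1 ler_nat; exact: card_addf_int.
have sumB (I : {fset int}) (F : int -> R) : \sum_(i <- I) F i = \sum_(i <- I) (F i - m) + m * #|` I|%:R.
  by rewrite sumrB big_const_seq count_predT iter_addr_0 mulr_natr subrK.
pose S' := [fset s in S | m < f s]; pose T' := [fset t in T | m < g t].
have S'P s : (s \in S') = (s \in S) && (m < f s) by rewrite !inE.
have T'P t : (t \in T') = (t \in T) && (m < g t) by rewrite !inE.
have dropS : \sum_(s <- S) (f s - m) = \sum_(s <- S') (f s - m).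
  rewrite (big_fset_incl _ (_ : S' `<=` S)) //.
    by apply/fsubsetP => s; rewrite S'P => /andP[].
  move=> s sS; rewrite S'P sS /= -leNgt => fs.
  by apply/eqP; rewrite subr_eq0 eq_le fs mf.
have dropT : \sum_(s <- T) (g s - m) = \sum_(s <- T') (g s - m).
  rewrite (big_fset_incl _ (_ : T' `<=` T)) //.
    by apply/fsubsetP => s; rewrite T'P => /andP[].
  move=> s sS; rewrite T'P sS /= -leNgt => fs.
  by apply/eqP; rewrite subr_eq0 eq_le fs mg.
have sST : \sum_(u <- addf S' T') (h u - m) <= \sum_(u <- addf S T) (h u - m).
  have S'T' : addf S' T' `<=` addf S T.
    by apply: addfS; apply/fsubsetP => s; rewrite (S'P, T'P) => /andP[].
  rewrite [leRHS](big_fsetID _ (mem (addf S' T'))) /=.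
  rewrite (_ : [fset _ in _ | _] = addf S' T'); last first.
    by apply/fsetP => u; rewrite !inE /= andbC; case: (boolP (u \in addf S' T')) => // /(fsubsetP S'T') ->.
  rewrite lerDl big_seq sumr_ge0 // => u; rewrite !inE /= => /andP[uST _].
  by rewrite subr_ge0 mh.
rewrite (sumB S f) (sumB T g) (sumB _ h) dropS dropT.
have [mmu|mmu] := ltP m mu; last first.
  have S'0 : S' = fset0.
    apply/eqP; rewrite -fsubset0; apply/fsubsetP => s; rewrite S'P => /andP[sS].
    by case/andP: (fS _ sS) => _ fmu; rewrite ltNge (le_trans fmu mmu).
  have T'0 : T' = fset0.
    apply/eqP; rewrite -fsubset0; apply/fsubsetP => s; rewrite T'P => /andP[sS].
    by case/andP: (gT _ sS) => _ fmu; rewrite ltNge (le_trans fmu mmu).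
  rewrite S'0 T'0 !big_seq_fset0.
  have : 0 <= \sum_(u <- addf S T) (h u - m).
    by rewrite big_seq sumr_ge0 // => u /mh; rewrite subr_ge0.
  by have := mf _ s1S; rewrite fs1; move: cST; lra.
have s1S' : s1 \in S' by rewrite S'P s1S fs1.
have t1T' : t1 \in T' by rewrite T'P t1T gt1.
have lt : (#|` S'| + #|` T'| < #|` S| + #|` T|)%N.
  have subS : S' `<=` S by apply/fsubsetP => s; rewrite S'P => /andP[].
  have subT : T' `<=` T by apply/fsubsetP => s; rewrite T'P => /andP[].
  have [mE|mE] : m = f s0 \/ m = g t0 by rewrite /m /Num.min; case: ifP; [left|right].
    have : (#|` S'| < #|` S|)%N.
      by rewrite fproper_ltn_card // fproperE subS; apply/fsubsetPn; exists s0; rewrite // S'P mE ltxx andbF.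
    by move=> lt; rewrite -addSn leq_add // fsubset_leq_card.
  have : (#|` T'| < #|` T|)%N.
    by rewrite fproper_ltn_card // fproperE subT; apply/fsubsetPn; exists t0; rewrite // T'P mE ltxx andbF.
  by move=> lt; rewrite -addnS leq_add // fsubset_leq_card.
have key : \sum_(s <- S') (f s - m) + \sum_(t <- T') (g t - m) - (mu - m) <=
    \sum_(u <- addf S' T') (h u - m).
  apply: IHn.
  - exact: leq_trans lt _.
  - by apply/fset0Pn; exists s1.
  - by apply/fset0Pn; exists t1.
  - by move=> s; rewrite S'P => /andP[/fS/andP[_ fmu] mfs]; rewrite subr_gt0 mfs lerD2r.
  - by move=> s; rewrite T'P => /andP[/gT/andP[_ fmu] mfs]; rewrite subr_gt0 mfs lerD2r.
  - by exists s1; rewrite ?fs1.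
  - by exists t1; rewrite ?gt1.
  - move=> s t; rewrite S'P T'P => /andP[sS _] /andP[tT _].
    have := hP _ _ sS tT; rewrite !ge_min => /orP[] h1; apply/orP; [left|right]; lra.
by move: cST sST key; lra.
Qed.

(** * A discrete Brunn-Minkowski inequality with an error counting lines *)

Section DiscreteBrunnMinkowski.
Variables (R : realType) (w : nat -> R).
Implicit Types (X Y Z : {fset R}) (k d : nat).
Local Notation card A := (#|` A|%:R : R).

Definition zspan k (x : R) := exists c : nat -> int, x = \sum_(i < k) w i *~ c i.

Lemma subgrp_zspan k : subgrp (zspan k).
Proof.
split; first by exists (fun=> 0); rewrite big1 // => i _; rewrite mulr0z.
move=> _ _ [a ->] [b ->]; exists (fun i => a i - b i).
by rewrite -sumrB; apply: eq_bigr => i _; rewrite mulrzBr.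
Qed.

Lemma zspan_mem k i m : (i < k)%N -> zspan k (w i *~ m).
Proof.
move=> ik; exists (fun j => if j == i then m else 0).
rewrite (bigD1 (Ordinal ik)) //= eqxx big1 ?addr0 // => j /negPf ji.
by rewrite -val_eqE /= in ji; rewrite ji mulr0z.
Qed.

Lemma zspanS k x : zspan k.+1 x -> exists m, zspan k (x - w k *~ m).
Proof.
by move=> [c ->]; exists (c k); exists c; rewrite big_ord_recr /= addrK.
Qed.

(** Linear independence over the integers, in the triangular form used when the last coordinate is
    split off. *)
Definition zfree d := forall k m, (k < d)%N -> zspan k (w k *~ m) -> m = 0.

(** The factor [2 ^+ k] is there because the induction on the dimension spends the error twice: on
    the sum of all sections and on the largest ones. *)
Definition line_err k Z : R :=
  2 ^+ k * \sum_(i < k) card (cosets (zmultiple (w i)) Z).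

Lemma line_err_ge0 k Z : 0 <= line_err k Z.
Proof. by rewrite mulr_ge0 ?exprn_ge0 ?sumr_ge0. Qed.

Lemma line_errS k Z Z' : Z `<=` Z' -> line_err k Z <= line_err k Z'.
Proof.
by move=> ZZ'; rewrite ler_wpM2l ?exprn_ge0 //; apply: ler_sum => i _; rewrite ler_nat cosetsS.
Qed.

Lemma card_cosets_partition (T : choiceType) (H : R -> Prop) (t : R -> T) Z : subgrp H ->
  (forall x y, x \in Z -> y \in Z -> H (x - y) -> t x = t y) ->
  #|` cosets H Z| = (\sum_(u <- t @` Z) #|` cosets H [fset z in Z | t z == u]|)%N.
Proof.
move=> sH tH.
have /choice[r rP] : forall c : R, exists x, c \in cosets H Z ->
    x \in Z /\ coset_rep H x = c.
  move=> c; have [/imfsetP[x /= xZ ->]|] := boolP (c \in cosets H Z); last by exists 0.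
  by exists x.
have tr x : x \in Z -> t (r (coset_rep H x)) = t x.
  move=> xZ; have cx : coset_rep H x \in cosets H Z by rewrite in_imfset.
  by have [rZ re] := rP _ cx; apply: tH => //; apply/(coset_rep_eq _ _ sH).
rewrite (card_partition (t \o r)).
have -> : [fset (t \o r) x | x in cosets H Z] = t @` Z.
  apply/fsetP => u; apply/imfsetP/imfsetP => /= -[x xZ ->].
    by have [rZ _] := rP _ xZ; exists (r x).
  by exists (coset_rep H x); rewrite ?in_imfset //= tr.
apply: eq_bigr => u _; congr #|` _|; apply/fsetP => c.
rewrite !inE /=; apply/andP/imfsetP => /= [[cZ /eqP cu]|[x]].
  by have [rZ <-] := rP _ cZ; exists (r c); rewrite // !inE rZ cu /=.
by rewrite !inE => /andP[xZ /eqP xu] ->; rewrite in_imfset //= tr // xu.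
Qed.

(** No line in a direction [w i] meets [Z] in two classes, so the errors of the classes add up
    exactly to that of [Z]. *)
Lemma sum_line_err (T : choiceType) k (t : R -> T) Z :
  (forall i x y, (i < k)%N -> x \in Z -> y \in Z -> zmultiple (w i) (x - y) -> t x = t y) ->
  \sum_(u <- t @` Z) (card [fset z in Z | t z == u] + line_err k [fset z in Z | t z == u])
    = card Z + line_err k Z.
Proof.
move=> tH; rewrite big_split /= -natr_sum -card_partition; congr (_ + _).
rewrite /line_err -mulr_sumr exchange_big /=; congr (_ * _); apply: eq_bigr => i _.
rewrite -natr_sum -card_cosets_partition //; first exact: subgrp_zmultiple.
by move=> x y; apply: tH.
Qed.

(** Cut along the coordinate of [w k] and divide the section sizes by their maxima [M] and [N]. By
    homogeneity the section of the sum at [s + t] has size at least [bm k M N] times the smaller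
    normalised size, up to error, as [sum_sections] requires. Its conclusion loses one [bm k M N]
    against [bm_step], and that is charged to the lines of direction [w k]. *)
Lemma brunn_minkowski_coset d k X Y : zfree d -> (k <= d)%N -> X != fset0 -> Y != fset0 ->
  (exists x0, {in X, forall x, zspan k (x - x0)}) ->
  (exists y0, {in Y, forall y, zspan k (y - y0)}) ->
  bm k (card X) (card Y) <= card (addf X Y) + line_err k (addf X Y).
Proof.
move=> wfree; elim: k X Y => [|k IHk] X Y kd X0 Y0 [x0 Xx0] [y0 Yy0].
  rewrite /bm expr0 ler_wpDr ?line_err_ge0 // ler1n cardfs_gt0 addf_neq0 //.
have sp := subgrp_zspan k.
have coord (W : {fset R}) p0 : {in W, forall x, zspan k.+1 (x - p0)} ->
    exists t : R -> int, {in W, forall x, zspan k (x - p0 - w k *~ t x)}.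
  move=> Wp; have /choice[t tP] : forall x, exists m : int, x \in W -> zspan k (x - p0 - w k *~ m).
    move=> x; have [xW|_] := boolP (x \in W); last by exists 0.
    by have [m mP] := zspanS (Wp _ xW); exists m.
  by exists t.
have [tX tXP] := coord X x0 Xx0; have [tY tYP] := coord Y y0 Yy0.
pose Z := addf X Y.
have [tZ tZP] : exists t : R -> int, {in Z, forall x, zspan k (x - (x0 + y0) - w k *~ t x)}.
  apply: coord => _ /addfP[x [y [xX yY ->]]].
  rewrite (_ : x + y - (x0 + y0) = (x - x0) + (y - y0)); last by ring.
  exact: subgrpD (subgrp_zspan _) (Xx0 _ xX) (Yy0 _ yY).
have uniq_t a b m m' : zspan k (a - w k *~ m) -> zspan k (b - w k *~ m') -> zspan k (a - b) -> m = m'.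
  move=> h1 h2 h3; apply/eqP; rewrite -subr_eq0; apply/eqP; apply: (wfree k) => //.
  rewrite mulrzBr.
  rewrite (_ : _ - _ = (a - b) - (a - w k *~ m) + (b - w k *~ m')); last by ring.
  by apply: subgrpD => //; apply: sp.2.
have tZD x y : x \in X -> y \in Y -> tZ (x + y) = tX x + tY y.
  move=> xX yY; apply: (uniq_t _ (x + y - (x0 + y0))) (tZP _ (mem_addf xX yY)) _ _.
    rewrite (_ : _ - _ = (x - x0 - w k *~ tX x) + (y - y0 - w k *~ tY y)); first exact: subgrpD sp (tXP _ xX) (tYP _ yY).
    by rewrite mulrzDr; ring.
  by rewrite (_ : _ - _ = 0); [exact: sp.1|ring].
pose sX s := [fset x in X | tX x == s]; pose sY s := [fset y in Y | tY y == s].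
pose sZ s := [fset z in Z | tZ z == s].
have sXP s x : (x \in sX s) = (x \in X) && (tX x == s) by rewrite !inE.
have sYP s x : (x \in sY s) = (x \in Y) && (tY x == s) by rewrite !inE.
have sZP s x : (x \in sZ s) = (x \in Z) && (tZ x == s) by rewrite !inE.
pose S := tX @` X; pose T := tY @` Y.
have sX0 s : s \in S -> sX s != fset0.
  by move=> /imfsetP[x /= xX ->]; apply/fset0Pn; exists x; rewrite sXP xX eqxx.
have sY0 s : s \in T -> sY s != fset0.
  by move=> /imfsetP[x /= xX ->]; apply/fset0Pn; exists x; rewrite sYP xX eqxx.
have S0 : S != fset0 by case/fset0Pn: X0 => x xX; apply/fset0Pn; exists (tX x); rewrite in_imfset.
have T0 : T != fset0 by case/fset0Pn: Y0 => x xX; apply/fset0Pn; exists (tY x); rewrite in_imfset.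
pose q u := card (sZ u) + line_err k (sZ u).
have sZ_sub s t : addf (sX s) (sY t) `<=` sZ (s + t).
  apply/fsubsetP => _ /addfP[x [y [+ + ->]]]; rewrite sXP sYP sZP.
  by move=> /andP[xX /eqP <-] /andP[yY /eqP <-]; rewrite tZD // mem_addf //= eqxx.
have qP s t : s \in S -> t \in T -> bm k (card (sX s)) (card (sY t)) <= q (s + t).
  move=> sS tT; apply: le_trans (IHk (sX s) (sY t) (ltnW kd) (sX0 _ sS) (sY0 _ tT) _ _) _.
  - exists (x0 + w k *~ s) => x; rewrite sXP => /andP[xX /eqP <-].
    by rewrite opprD addrA; apply: tXP.
  - exists (y0 + w k *~ t) => x; rewrite sYP => /andP[xX /eqP <-].
    by rewrite opprD addrA; apply: tYP.
  by rewrite lerD ?line_errS // ler_nat fsubset_leq_card.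
have [s1 s1S s1P] := fset_argmax (fun s => card (sX s)) S0.
have [t1 t1T t1P] := fset_argmax (fun s => card (sY s)) T0.
pose M := card (sX s1); pose N := card (sY t1).
have M0 : 0 < M by rewrite ltr0n cardfs_gt0 sX0.
have N0 : 0 < N by rewrite ltr0n cardfs_gt0 sY0.
have bm0 : 0 < bm k M N by apply: bm_gt0.
have sumX : \sum_(s <- S) card (sX s) / M = card X / M.
  by rewrite -mulr_suml -natr_sum -card_partition.
have sumY : \sum_(s <- T) card (sY s) / N = card Y / N.
  by rewrite -mulr_suml -natr_sum -card_partition.
have PL := @sum_sections R S T (fun s => card (sX s) / M) (fun s => card (sY s) / N)
  (fun u => q u / bm k M N) 1 S0 T0.
have {}PL : bm k M N * (card X / M + card Y / N) <= \sum_(u <- addf S T) q u + bm k M N.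
  rewrite -lerBlDr -[X in _ - X]mulr1 -mulrBr -ler_pdivlMl // mulr_sumr.
  under eq_bigr do rewrite mulrC.
  rewrite -sumX -sumY; apply: PL.
  - by move=> s sS; rewrite divr_gt0 ?ler_pdivrMr ?mul1r ?s1P // ltr0n cardfs_gt0 sX0.
  - by move=> s sS; rewrite divr_gt0 ?ler_pdivrMr ?mul1r ?t1P // ltr0n cardfs_gt0 sY0.
  - by exists s1; rewrite ?divff // gt_eqF.
  - by exists t1; rewrite ?divff // gt_eqF.
  move=> s t sS tT; rewrite ler_pdivlMr //; apply: le_trans (qP _ _ sS tT).
  set th := Num.min _ _.
  have th0 : 0 <= th by rewrite le_min !divr_ge0 // ltW.
  have th1 : th <= 1 by rewrite ge_min ler_pdivrMr // mul1r s1P.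
  apply: le_trans (bm_minZ _ _ (ltW M0) (ltW N0)) _; first by rewrite th0.
  apply: le_bm; try (by rewrite mulr_ge0 // ltW).
    by rewrite -ler_pdivlMr // ge_min lexx.
  by rewrite -ler_pdivlMr // ge_min lexx orbT.
have addST : addf S T = tZ @` Z.
  apply/fsetP => u; apply/addfP/imfsetP => /=.
    move=> [_ [_ [/imfsetP[x /= xX ->] /imfsetP[y /= yY ->] ->]]].
    by exists (x + y); rewrite ?mem_addf // tZD.
  move=> [_ /addfP[x [y [xX yY ->]]] ->]; rewrite tZD //.
  by exists (tX x), (tY y); rewrite !in_imfset.
have sumq : \sum_(u <- addf S T) q u = card Z + line_err k Z.
  rewrite addST; apply: sum_line_err => i x y ik xZ yZ [m xy].
  apply: uniq_t (tZP _ xZ) (tZP _ yZ) _.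
  have -> : x - (x0 + y0) - (y - (x0 + y0)) = x - y by ring.
  by rewrite xy; apply: zspan_mem.
(* The two largest sections add up inside a single section of [Z], and by independence a line of
   direction [w k] meets a section at most once. *)
have bmMN : bm k M N <= card (cosets (zmultiple (w k)) Z) + line_err k Z.
  apply: (le_trans (qP _ _ s1S t1T)); rewrite lerD //; last first.
    by apply: line_errS; apply/fsubsetP => x; rewrite sZP => /andP[].
  rewrite ler_nat; apply: (@leq_card_inj _ _ (coset_rep (zmultiple (w k)))).
    move=> x y; rewrite !sZP => /andP[xZ /eqP xu] /andP[yZ /eqP yu].
    move=> /(coset_rep_eq _ _ (subgrp_zmultiple _))[m xy].
    have m0 : m = 0.
      apply: (wfree k) => //; rewrite -xy.
      rewrite (_ : x - y = (x - (x0 + y0) - w k *~ tZ x) - (y - (x0 + y0) - w k *~ tZ y)).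
        by apply: sp.2; apply: tZP.
      by rewrite xu yu; ring.
    by apply/eqP; rewrite -subr_eq0 xy m0 mulr0z.
  by move=> x; rewrite sZP => /andP[xZ _]; rewrite in_imfset.
have step : bm k.+1 (card X) (card Y) <= bm k M N * (card X / M + card Y / N).
  apply: bm_step => // k0.
  have single (W : {fset R}) p0 (t : R -> int) s : k = 0%N -> {in W, forall x, zspan k (x - p0 - w k *~ t x)} ->
      (#|` [fset x in W | t x == s]| <= 1)%N.
    move=> k0' Wt; rewrite -(cardfs1 (p0 + w k *~ s)); apply: fsubset_leq_card.
    apply/fsubsetP => x; rewrite !inE /= => /andP[xW /eqP <-].
    have := Wt _ xW; rewrite k0' => -[c]; rewrite big_ord0 => /eqP.
    by rewrite -addrA -opprD subr_eq0.
  split; apply/eqP; rewrite eq_le.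
    by rewrite ler1n cardfs_gt0 sX0 // lern1 (single _ _ _ _ k0 tXP).
  by rewrite ler1n cardfs_gt0 sY0 // lern1 (single _ _ _ _ k0 tYP).
have errS : line_err k.+1 Z = 2 * line_err k Z + 2 ^+ k.+1 * card (cosets (zmultiple (w k)) Z).
  by rewrite /line_err big_ord_recr /= mulrDr exprS mulrA.
have e1 : card (cosets (zmultiple (w k)) Z) <= 2 ^+ k.+1 * card (cosets (zmultiple (w k)) Z).
  by rewrite ler_peMl // exprn_ege1 // ler1n.
rewrite -/Z errS; move: step PL e1 bmMN; rewrite sumq; lra.
Qed.

(** Several classes modulo the span may occur. Keep all classes of one set [W1] and only the largest
    class, of size [N], of the other. The class sums are disjoint, and if [M] is the largest class
    size of [W1] they total [|W1| / M] times [bm d M N], which equals [bm d] at [|W1|] and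
    [|W1| N / M]. This suffices when [W1] has the larger ratio of size to largest class. *)
Lemma brunn_minkowski d X Y : zfree d -> (0 < d)%N -> X != fset0 -> Y != fset0 ->
  bm d (card X) (card Y) <= card (addf X Y) + line_err d (addf X Y).
Proof.
move=> wfree d0; have sp := subgrp_zspan d; pose t := coset_rep (zspan d).
have teq x y : t x = t y <-> zspan d (x - y) by apply: coset_rep_eq.
pose sec (W : {fset R}) u := [fset x in W | t x == u].
have secP W u x : (x \in sec W u) = (x \in W) && (t x == u) by rewrite !inE.
have sec0 (W : {fset R}) u : u \in t @` W -> sec W u != fset0.
  by move=> /imfsetP[x /= xX ->]; apply/fset0Pn; exists x; rewrite secP xX eqxx.
have image0 (W : {fset R}) : W != fset0 -> t @` W != fset0.
  by case/fset0Pn => x xW; apply/fset0Pn; exists (t x); rewrite in_imfset.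
have main (W1 W2 : {fset R}) u1 u2 : W1 != fset0 -> u1 \in t @` W1 -> u2 \in t @` W2 ->
    {in t @` W1, forall u, card (sec W1 u) <= card (sec W1 u1)} ->
    card W2 / card (sec W2 u2) <= card W1 / card (sec W1 u1) ->
    bm d (card W1) (card W2) <= card (addf W1 W2) + line_err d (addf W1 W2).
  move=> W10 u1W u2W u1P ratio; pose M := card (sec W1 u1); pose N := card (sec W2 u2).
  have M0 : 0 < M by rewrite ltr0n cardfs_gt0 sec0.
  have N0 : 0 < N by rewrite ltr0n cardfs_gt0 sec0.
  pose Z := addf W1 (sec W2 u2).
  have subZ : Z `<=` addf W1 W2.
    by apply: addfS => //; apply/fsubsetP => x; rewrite secP => /andP[].
  apply: (@le_trans _ _ (card Z + line_err d Z)); last first.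
    by rewrite lerD ?line_errS // ler_nat fsubset_leq_card.
  have [y2 y2W y2E] : exists2 y, y \in W2 & t y = u2 by case/imfsetP: u2W => y /= ? ->; exists y.
  pose tt x := t (x + y2).
  have ttP x y : tt x = tt y <-> t x = t y.
    rewrite /tt teq (_ : _ - _ = x - y); last by ring.
    by rewrite teq.
  have tZ x y : x \in W1 -> y \in sec W2 u2 -> t (x + y) = tt x.
    rewrite secP -y2E => xW /andP[yW /eqP ty]; apply/teq.
    by rewrite (_ : _ - _ = y - y2); [apply/teq|ring].
  rewrite -(sum_line_err (t := t)); last first.
    by move=> i x y id _ _ [m xy]; apply/teq; rewrite xy; apply: zspan_mem.
  have -> : t @` Z = tt @` W1.
    apply/fsetP => u; apply/imfsetP/imfsetP => /=.
      by move=> [_ /addfP[x [y [xW ys ->]]] ->]; exists x => //; apply: tZ.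
    by move=> [x xW ->]; exists (x + y2) => //; rewrite mem_addf // secP y2W y2E eqxx.
  apply: (@le_trans _ _ (card W1 / M * bm d M N)).
    have -> : card W1 / M * bm d M N = bm d (card W1) (card W1 / M * N).
      rewrite -(bmZ d0 (_ : 0 <= card W1 / M) (ltW M0) (ltW N0)) ?divr_ge0 //.
      by rewrite divfK // gt_eqF.
    by apply: le_bm => //; rewrite -ler_pdivrMr.
  rewrite (card_partition tt) natr_sum !mulr_suml !big_seq; apply: ler_sum => u uW.
  have [x xW uE] : exists2 x, x \in W1 & u = tt x by case/imfsetP: uW => x /= ? ->; exists x.
  have -> : [fset x in W1 | tt x == u] = sec W1 (t x).
    apply/fsetP => y; rewrite !inE /= uE; congr (_ && _).
    by apply/eqP/eqP => /ttP.
  have txW : t x \in t @` W1 by rewrite in_imfset.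
  have sW0 := sec0 _ _ txW.
  apply: (@le_trans _ _ (bm d (card (sec W1 (t x))) N)).
    apply: le_trans (bm_minZ _ _ (ltW M0) (ltW N0)) _.
      by rewrite divr_ge0 //= ler_pdivrMr // mul1r u1P.
    rewrite divfK ?gt_eqF //; apply: le_bm => //; first by rewrite mulr_ge0 ?divr_ge0.
    by rewrite ler_piMl // ler_pdivrMr // mul1r u1P.
  apply: (@le_trans _ _ (card (addf (sec W1 (t x)) (sec W2 u2)) + line_err d (addf (sec W1 (t x)) (sec W2 u2)))).
    apply: brunn_minkowski_coset wfree (leqnn d) sW0 (sec0 _ _ u2W) _ _.
      by exists x => y; rewrite secP => /andP[_ /eqP/teq].
    by exists y2 => y; rewrite secP -y2E => /andP[_ /eqP/teq].
  have sub : addf (sec W1 (t x)) (sec W2 u2) `<=` [fset z in Z | t z == u].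
    apply/fsubsetP => _ /addfP[a [b [+ bs ->]]]; rewrite secP => /andP[aW /eqP ta].
    rewrite !inE /= mem_addf //= tZ // uE; apply/eqP; exact/ttP.
  by rewrite lerD ?line_errS // ler_nat fsubset_leq_card.
move=> X0 Y0.
have [s1 s1S s1P] := fset_argmax (fun s => card (sec X s)) (image0 _ X0).
have [t1 t1T t1P] := fset_argmax (fun s => card (sec Y s)) (image0 _ Y0).
have [le|/ltW le] := leP (card Y / card (sec Y t1)) (card X / card (sec X s1)).
  exact: main le.
rewrite bmC addfC; exact: main le.
Qed.

End DiscreteBrunnMinkowski.

(** * Gauss's lemma, reversed polynomials and the index bound *)

Section Gauss.
Variables (R : realType) (lam : R) (p : {poly int}).
Hypotheses (pmin : is_min_poly_int lam p) (pprim : primitive_int_poly p).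

Lemma primitive_contents : `|zcontents p|%N = 1%N.
Proof.
have [p0 _ _] := pmin.
have c0 : (0 < `|zcontents p|)%N by rewrite absz_gt0 zcontents_eq0.
apply/eqP; rewrite eqn_leq c0 andbT leqNgt; apply/negP => c1.
have [i /negP] := pprim (pdiv_prime c1); apply.
have : ((pdiv `|zcontents p|)%:Z %| zcontents p)%Z by rewrite dvdzE /= pdiv_dvd.
by rewrite dvdz_contents => /polyOverP/(_ i).
Qed.

Lemma gauss_dvd (f : {poly int}) : (map_poly (intr : int -> R) f).[lam] = 0 ->
  exists q, f = q * p.
Proof.
move=> flam; have [p0 plam pm] := pmin.
have ratK (h : {poly int}) :
    map_poly (ratr : rat -> R) (map_poly (intr : int -> rat) h) = map_poly intr h.
  by rewrite -map_poly_comp; apply: eq_map_poly => z /=; rewrite ratr_int.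
pose pQ := map_poly (intr : int -> rat) p; pose fQ := map_poly (intr : int -> rat) f.
have pQ0 : pQ != 0 by rewrite map_poly_eq0_id0 // intr_eq0 lead_coef_eq0.
have size_pQ : size pQ = size p by rewrite size_map_inj_poly //; apply: intr_inj.
have /dvdpP dvdQ : pQ %| fQ.
  rewrite /dvdp; apply/negPn/negP => r0.
  have := pm _ r0; rewrite leqNgt -size_pQ ltn_modp pQ0 => h.
  have : false by apply: h; rewrite -[RHS]flam -(ratK f) -/fQ [in RHS](divp_eq fQ pQ) rmorphD rmorphM /= hornerD hornerM ratK plam mulr0 add0r.
  by [].
have : p %| f by rewrite -dvdp_rat_int; apply/dvdpP.
case/Pdiv.Idomain.dvdpP => -[c q] /= c0 cf.
have cp := primitive_contents.
(* Primitivity makes [e] a sign, hence its own inverse. *)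
pose e := zcontents p.
have ee : e * e = 1 by move: cp; rewrite -/e; case: (e) => [[|[|]]|[|]].
exists ((zcontents f * e) *: zprimitive q).
have cq : c * zcontents f = zcontents q * e by rewrite -zcontentsZ cf zcontentsM.
apply: (@mulfI _ c%:P); rewrite ?polyC_eq0 // !mul_polyC.
rewrite cf -scalerAl scalerA mulrA cq -mulrA ee mulr1 scalerAl -zpolyEprim //.
Qed.

End Gauss.

Lemma gauss_coef0 (R : realType) (lam : R) (p f : {poly int}) :
  is_min_poly_int lam p -> primitive_int_poly p ->
  (map_poly (intr : int -> R) f).[lam] = 0 -> f`_0 != 0 -> (absz (p`_0)%R <= absz (f`_0)%R)%N.
Proof.
move=> pmin pprim flam f0; have [q fE] := gauss_dvd pmin pprim flam.
move: f0; rewrite fE -!horner_coef0 hornerM abszM mulf_eq0 negb_or => /andP[q0 _].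
by rewrite leq_pmull // absz_gt0.
Qed.

Lemma horner_rev (R : realType) (lam : R) (K : nzRingType) (h : K -> R) (q : {poly K}) :
  lam != 0 -> h 0 = 0 ->
  (map_poly h (Poly (rev q))).[lam^-1] * lam ^+ (size q).-1 = (map_poly h q).[lam].
Proof.
move=> lam0 h0; have [->|q0] := eqVneq q 0.
  by rewrite polyseq0 /= map_poly0 !horner0 mul0r.
have sq : (0 < size q)%N by rewrite size_poly_gt0.
have sr : (size (Poly (rev q)) <= size q)%N by rewrite (leq_trans (size_Poly _)) // size_rev.
have hc (u : {poly K}) n x : (size u <= n)%N -> (map_poly h u).[x] = \sum_(i < n) h u`_i * x ^+ i.
  move=> un; rewrite (@horner_coef_wide _ n) ?(leq_trans (size_poly _ _)) //.
  by apply: eq_bigr => i _; rewrite coef_map_id0.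
rewrite (hc _ _ _ sr) (hc _ _ _ (leqnn _)) mulr_suml (reindex_inj rev_ord_inj) /=.
apply: eq_bigr => i _; rewrite coef_Poly nth_rev ?ltn_subrL ?sq //.
have iq := ltn_ord i; rewrite -mulrA.
have e1 (a b : nat) : (a < b)%N -> (b - (b - a.+1).+1 = a)%N by lia.
have e2 (a b : nat) : (a < b)%N -> (b.-1 = (b - a.+1) + a)%N by lia.
rewrite e1 // exprVn (e2 i) //.
by rewrite exprD mulKf // expf_neq0.
Qed.

Lemma min_poly_coef0_neq0 (R : realType) (lam : R) (p : {poly int}) :
  lam != 0 -> is_min_poly_int lam p -> p`_0 != 0.
Proof.
move=> lam0 [p0 plam pmin].
apply/negP => /eqP p00; have /factor_theorem[q pE] : root p 0 by rewrite /root horner_coef0 p00.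
have q0 : q != 0 by apply: contraNneq p0 => q0; rewrite pE q0 mul0r.
have qQ0 : map_poly (intr : int -> rat) q != 0.
  by rewrite map_poly_eq0_id0 // intr_eq0 lead_coef_eq0.
have qlam : (map_poly (ratr : rat -> R) (map_poly intr q)).[lam] = 0.
  have -> : map_poly (ratr : rat -> R) (map_poly intr q) = map_poly intr q.
    by rewrite -map_poly_comp; apply: eq_map_poly => z /=; rewrite ratr_int.
  apply/eqP; move: plam; rewrite pE subr0 rmorphM /= map_polyX hornerM hornerX => /eqP.
  by rewrite mulf_eq0 (negPf lam0) orbF.
have := pmin _ qQ0 qlam.
by rewrite (size_map_inj_poly (@intr_inj _)) // pE subr0 size_mulX // ltnn.
Qed.

(** Replacing [lam] by its inverse exchanges rows and columns as well as [|a_0|] and [|a_d|], so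
    only rows need be treated. *)
Lemma is_min_poly_int_rev (R : realType) (lam : R) (p : {poly int}) :
  lam != 0 -> is_min_poly_int lam p ->
  is_min_poly_int lam^-1 (Poly (rev p)) /\ size (Poly (rev p)) = size p.
Proof.
move=> lam0 [p0 plam pmin].
have sp : (0 < size p)%N by rewrite size_poly_gt0.
have p00 := min_poly_coef0_neq0 lam0 (And3 p0 plam pmin).
have srev : size (Poly (rev p)) = size p.
  have -> : Poly (rev p) = rev p :> seq int.
    apply: (@PolyK _ 0); move: p00; case: (polyseq p) sp => //= a s _.
    by rewrite rev_cons last_rcons.
  by rewrite size_rev.
split=> //; split.
- by rewrite -size_poly_gt0 srev.
- apply: (@mulIf _ (lam ^+ (size p).-1)); first by rewrite expf_neq0.
  by rewrite mul0r horner_rev.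
move=> q q0 qlam; rewrite srev.
have qr0 : Poly (rev q) != 0.
  apply: contraNneq q0 => qr0; apply/eqP/polyP => i; rewrite coef0.
  have [iq|iq] := ltnP i (size q); last by rewrite nth_default.
  have := congr1 (fun u : {poly rat} => u`_(size q - i.+1)) qr0.
  rewrite coef0 coef_Poly nth_rev; last by rewrite ltn_subrL (leq_ltn_trans _ iq).
  by rewrite -subSn // subSS subKn // ltnW.
apply: leq_trans (pmin _ qr0 _) _; last by rewrite (leq_trans (size_Poly _)) // size_rev.
apply: (@mulIf _ (lam^-1 ^+ (size q).-1)); first by rewrite expf_neq0 // invr_eq0.
by rewrite mul0r -[X in _.[X]](invrK lam) horner_rev ?invr_eq0 ?rmorph0.
Qed.

Lemma primitive_int_poly_rev (p : {poly int}) : p`_0 != 0 ->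
  primitive_int_poly p -> primitive_int_poly (Poly (rev p)).
Proof.
move=> p00 pprim q /pprim[i qi]; exists (size p - i.+1)%N.
have iq : (i < size p)%N.
  by rewrite ltnNge; apply: contraNN qi => /(nth_default 0) ->; rewrite dvdz0.
rewrite coef_Poly nth_rev; last by rewrite ltn_subrL (leq_ltn_trans _ iq).
by rewrite -subSn // subSS subKn // ltnW.
Qed.

Lemma zspan_le (R : realType) (g : nat -> R) k l x : (k <= l)%N -> zspan g k x -> zspan g l x.
Proof.
move=> kl [c ->]; exists (fun i => if (i < k)%N then c i else 0).
rewrite (big_ord_widen l (fun i => g i *~ c i)) // big_mkcond /=.
by apply: eq_bigr => i _; case: ifP => _; rewrite ?mulr0z.
Qed.

(* A triangular integer matrix [S'] with minimal diagonal expresses multiples of the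
   generators inside [lam L]; [det (S' - x S)] then vanishes at [lam]. *)
Lemma index_ge (R : realType) (lam : R) (p : {poly int}) (g : nat -> R) N (T : {fset R}) :
  is_min_poly_int lam p -> primitive_int_poly p ->
  (exists2 i, (i < N)%N & g i != 0) ->
  (forall x, zspan g N x -> exists2 t, t \in T & exists2 y, zspan g N y & x - t = lam * y) ->
  (absz (p`_0)%R <= #|` T|)%N.
Proof.
move=> pmin pprim [i0 i0N gi0] cover.
have sg k := subgrp_zspan g k.
pose L x := exists2 y, zspan g N y & x = lam * y.
have sL : subgrp L.
  split; first by exists 0; rewrite ?mulr0 //; apply: (sg N).1.
  move=> _ _ [x xL ->] [y yL ->]; exists (x - y); rewrite ?mulrBr //.
  exact: (sg N).2.
have /choice[f fP] : forall x, exists t, zspan g N x -> t \in T /\ L (x - t).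
  move=> x; have [xL|nxL] := pselect (zspan g N x); last by exists 0.
  by have [t tT [y yL e]] := cover x xL; exists t => _; split=> //; exists y.
have fL x y : zspan g N x -> zspan g N y -> f x = f y -> L (x - y).
  move=> xL yL fxy; have [_ h1] := fP _ xL; have [_ h2] := fP _ yL.
  rewrite (_ : x - y = (x - f x) - (y - f y)); first exact: sL.2.
  by rewrite fxy; ring.
(* [m] copies of [g i] are congruent modulo [lam L] to a combination of earlier generators. The
   least such [m] is the [i]-th diagonal entry. *)
pose good i m := (0 < m)%N /\ exists2 y, zspan g i y & L (g i *+ m + y).
have gN i m : (i < N)%N -> zspan g N (g i *+ m) by move=> iN; rewrite pmulrn; apply: zspan_mem.
have exgood i : (i < N)%N -> exists m, `[< good i m >].
  move=> iN; have [inj|] := pselect {in iota 0 #|` T|.+1 &, injective (fun m => f (g i *+ m))}.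
    have := @leq_card_inj _ _ (fun m => f (g i *+ m)) [fset m in iota 0 #|` T|.+1] T.
    rewrite card_fseq undup_id ?iota_uniq // size_iota ltnn => h; have : false; last by [].
    apply: h; first by move=> x y; rewrite !inE; apply: inj.
    by move=> m _; case: (fP (g i *+ m)) => //; apply: gN.
  move=> ninj; have [m [m' [mm' fmm']]] : exists m m', (m < m')%N /\ f (g i *+ m) = f (g i *+ m').
    apply: contrapT => nex; apply: ninj => m m' _ _ e.
    have [lt|lt|//] := ltngtP m m'; case: nex; first by exists m, m'.
    by exists m', m.
  exists (m' - m)%N; apply/asboolP; split; first by rewrite subn_gt0.
  exists 0; first exact: (sg i).1.
  by rewrite addr0 mulrnBr ?(ltnW mm') //; apply: fL => //; apply: gN.
have /choice[m mP] : forall i, exists m, (i < N)%N -> good i m /\ forall m', good i m' -> (m <= m')%N.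
  move=> i; have [iN|_] := ltnP i N; last by exists 0.
  exists (ex_minn (exgood i iN)) => _; case: ex_minnP => k /asboolP gk kP.
  by split=> // k' /asboolP; apply: kP.
(* Minimality makes the combinations with coefficients below the diagonal pairwise incongruent
   modulo [lam L], so the product of the diagonal is at most [|T|]. *)
have Ui i : (i <= N)%N -> exists U : {fset R}, [/\ {in U, forall x, zspan g i x},
    {in U &, forall x y, L (x - y) -> x = y} & #|` U| = (\prod_(j < i) m j)%N].
  elim: i => [_|i IHi iN].
    exists [fset 0]; split; last by rewrite cardfs1 big_ord0.
      by move=> x /fset1P ->; apply: (sg 0%N).1.
    by move=> x y /fset1P -> /fset1P ->.
  have [U [UL Ud Uc]] := IHi (ltnW iN); have [[mi0 _] mmin] := mP i iN.
  have key u u' t t' : u \in U -> u' \in U -> (t < m i)%N -> (t' < m i)%N ->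
      L ((u + g i *+ t) - (u' + g i *+ t')) -> u = u' /\ t = t'.
    wlog tt' : u u' t t' / (t' <= t)%N => [hw|] uU u'U tm t'm h.
      have [le|/ltnW le] := leqP t' t; first exact: hw.
      have h' : L (u' + g i *+ t' - (u + g i *+ t)) by apply: (subgrpNE sL); rewrite opprB.
      by have [-> ->] := hw u' u t' t le u'U uU t'm tm h'.
    have {}h : L (g i *+ (t - t') + (u - u')).
      rewrite mulrnBr //.
      by have -> : g i *+ t - g i *+ t' + (u - u') = (u + g i *+ t) - (u' + g i *+ t') by ring.
    have [tt0|tt0] := posnP (t - t')%N.
      have tE : t = t' by apply/eqP; rewrite eqn_leq tt' andbT -subn_eq0 tt0.
      by split=> //; apply: Ud => //; move: h; rewrite tt0 mulr0n add0r.
    have := mmin (t - t')%N; rewrite leqNgt (leq_ltn_trans (leq_subr _ _) tm) => h'.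
    have : false; last by [].
    apply: h'; split=> //; exists (u - u') => //.
    by apply: (sg i).2; apply: UL.
  exists (addf U (progr (g i) (m i))); split.
  - move=> _ /addfP[u [_ [uU /progrP[t _ ->] ->]]]; apply: (subgrpD (sg _)).
      by apply: zspan_le (UL _ uU).
    by rewrite pmulrn; apply: zspan_mem.
  - move=> _ _ /addfP[u [_ [uU /progrP[t tm ->] ->]]] /addfP[u' [_ [u'U /progrP[t' t'm ->] ->]]].
    by move=> /key[] // -> ->.
  rewrite big_ord_recr /= -Uc; apply/eqP; rewrite eqn_leq; apply/andP; split.
    by rewrite (leq_trans (leq_card_addf _ _)) // leq_mul // card_progr.
  have cI : #|` [fset t in iota 0 (m i)]| = m i.
    by rewrite card_fseq undup_id ?iota_uniq // size_iota.
  rewrite -[X in (_ * X <= _)%N]cI -cardfsM.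
  apply: (@leq_card_inj _ _ (fun q => q.1 + g i *+ q.2)).
    move=> [u t] [u' t']; rewrite !in_fsetM !inE /= !mem_iota /= => /andP[uU tm] /andP[u'U t'm] e.
    have [|-> -> //] := key u u' t t' uU u'U tm t'm.
    by rewrite e subrr; apply: sL.1.
  move=> [u t]; rewrite !in_fsetM !inE /= mem_iota /= => /andP[uU tm].
  by rewrite mem_addf //; apply/progrP; exists t.
have [U [UL Ud Uc]] := Ui N (leqnn N).
have UT : (#|` U| <= #|` T|)%N.
  apply: (@leq_card_inj _ _ f) => [x y xU yU fxy|x /UL/fP[]//].
  by apply: Ud => //; apply: fL => //; apply: UL.
have /choice[c cP] : forall i, exists c : (nat -> int) * (nat -> int), (i < N)%N ->
    g i *+ m i + \sum_(j < i) g j *~ c.1 j = lam * \sum_(j < N) g j *~ c.2 j.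
  move=> i; have [iN|_] := ltnP i N; last by exists (fun=> 0, fun=> 0).
  have [[_ [_ [c1 ->] [_ [c2 ->] e]]] _] := mP i iN.
  by exists (c1, c2).
pose S' : 'M[int]_N := \matrix_(i, j) (if (j < i)%N then (c i).1 j else if j == i then (m i)%:Z else 0).
pose S : 'M[int]_N := \matrix_(i, j) (c i).2 j.
have detS' : \det S' = (\prod_(j < N) m j)%N.
  rewrite det_trig; last first.
    by apply/is_trig_mxP => i j ij; rewrite mxE ltnNge (ltnW ij) /= -val_eqE /= gtn_eqF.
  rewrite (big_morph Posz PoszM (erefl 1%:Z)).
  by apply: eq_bigr => i _; rewrite mxE ltnn eqxx.
(* By the relations [cP], this matrix evaluated at [lam] kills the nonzero vector [g]. *)
pose M : 'M[{poly int}]_N := map_mx polyC S' - 'X *: map_mx polyC S.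
have M0 : (\det M)`_0 = (\prod_(j < N) m j)%N.
  rewrite -horner_coef0 -horner_evalE -det_map_mx -detS'; congr (\det _).
  by apply/matrixP => i j; rewrite !mxE /= /horner_eval !hornerE.
have Mlam : (map_poly (intr : int -> R) (\det M)).[lam] = 0.
  pose phi : {rmorphism {poly int} -> R} := horner_eval lam \o map_poly intr.
  have -> : (map_poly (intr : int -> R) (\det M)).[lam] = phi (\det M) by [].
  rewrite -det_map_mx -det_tr; apply/eqP/det0P; exists (\row_j g j).
    by apply: contraNneq gi0 => /matrixP/(_ 0 (Ordinal i0N)); rewrite !mxE /= => ->.
  apply/rowP => i; rewrite !mxE.
  under eq_bigr => j _.
    rewrite !mxE /= /phi /= /horner_eval rmorphB rmorphM /= map_polyX !map_polyC /= !hornerE mulrBr.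
    over.
  rewrite sumrB; apply/eqP; rewrite subr_eq0; apply/eqP.
  have -> : \sum_(j < N) g j * (lam * ((c i).2 j)%:~R) = lam * \sum_(j < N) g j *~ (c i).2 j.
    by rewrite mulr_sumr; apply: eq_bigr => j _; rewrite -mulrzr; ring.
  rewrite -cP // (bigID (fun j : 'I_N => (j < i)%N)) /= addrC; congr (_ + _).
    rewrite (bigD1 i) ?ltnn //= eqxx big1 ?addr0; first by rewrite -mulr_natr.
    by move=> j /andP[/negPf -> /negPf ->]; rewrite mulr0.
  rewrite (big_ord_widen N (fun j => g j *~ (c i).1 j)) 1?ltnW //.
  by apply: eq_bigr => j ->; rewrite mulrzr.
have m0 : (0 < \prod_(j < N) m j)%N.
  by rewrite prodn_cond_gt0 // => j _; have [[]] := mP j (ltn_ord j).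
have := gauss_coef0 pmin pprim Mlam; rewrite M0 /= -Uc => /(_ _).
rewrite eqz_nat -lt0n Uc m0 => /(_ isT) h; apply: leq_trans h _; rewrite -Uc //.
Qed.

(** * The difference group and the subclasses of a cell *)

Section DifferenceGroup.
Variable R : realType.
Implicit Types (A B E X Y : {fset R}) (lam mu : R).

(** The group [L], as an intersection of subgroups: closure properties of [L] are then proved by
    exhibiting a subgroup containing the differences. *)
Definition dgroup A (x : R) := forall H : R -> Prop, subgrp H ->
  {in A &, forall a b, H (a - b)} -> H x.

Lemma subgrp_dgroup A : subgrp (dgroup A).
Proof.
split; first by move=> H [].
move=> x y xA yA H sH HA; apply: sH.2; [exact: xA|exact: yA].
Qed.

Lemma dgroupB A a b : a \in A -> b \in A -> dgroup A (a - b).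
Proof. by move=> aA bA H sH; apply. Qed.

(** A preimage, so the parameter is inverted: [lam^-1] stands for [lam L] (rows) and [lam] for
    [lam^-1 L] (columns). *)
Definition dil_dgroup A mu (x : R) := dgroup A (mu * x).

Lemma subgrp_dil_dgroup A mu : subgrp (dil_dgroup A mu).
Proof.
have sA := subgrp_dgroup A; split; rewrite /dil_dgroup; first by rewrite mulr0; apply: sA.1.
by move=> x y hx hy; rewrite mulrBr; apply: sA.2.
Qed.

Lemma dgroup_zspan A a : a \in A ->
  dgroup A = zspan (fun i => nth a A i - a) #|` A|.
Proof.
move=> aA; set g := fun i => _; apply/funext => x; apply/propext; split.
  apply; first exact: subgrp_zspan.
  have gA b : b \in A -> zspan g #|` A| (b - a).
    move=> bA; have iA : (index b A < #|` A|)%N by rewrite index_mem.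
    rewrite -[b in b - a](nth_index a (s := A)) // -[_ - a]/(g (index b A)) -[g _]mulr1z.
    exact: zspan_mem.
  move=> b b' bA b'A; rewrite (_ : b - b' = (b - a) - (b' - a)); last by ring.
  by apply: (subgrp_zspan _ _).2; apply: gA.
move=> [c ->] H sH HA.
have Hz y (k : int) : H y -> H (y *~ k).
  move=> Hy; have Hn (n : nat) : H (y *+ n).
    by elim: n => [|n IHn]; [exact: sH.1|rewrite mulrS; apply: subgrpD].
  by case: k => n; [apply: Hn|rewrite NegzE mulrNz; apply: subgrpN sH _; apply: Hn].
elim/big_ind: _ => [|y z Hy Hz'|i _]; [exact: sH.1|exact: subgrpD|].
by apply: Hz; apply: HA => //; apply: mem_nth; apply: ltn_ord.
Qed.

(* Translating by differences of [A] permutes the subclasses modulo [lam^2 L]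
   of a class [E], unless some translate of [lam B_y] produces new sums. *)
Lemma subclasses_full lam A B E x0 : lam != 0 -> x0 \in E -> E `<=` B -> B `<=` A ->
  {in E, forall x, dil_dgroup A lam^-1 (x - x0)} ->
  {in A, forall y, exists2 y', y' \in B & dil_dgroup A lam^-1 (y - y')} ->
  (forall l, dgroup A l -> exists2 x, x \in E & dil_dgroup A (lam^-1 ^+ 2) (x - x0 - lam * l))
  \/ exists2 y, y \in B &
     (#|` addf E (dilf lam E)| + #|` [fset y' in B | `[< dil_dgroup A lam^-1 (y' - y) >]]|
       <= #|` addf E (dilf lam B)|)%N.
Proof.
move=> lam0 x0E EB BA Erow Brows.
have sA := subgrp_dgroup A.
have s1 := subgrp_dil_dgroup A lam^-1; have s2 := subgrp_dil_dgroup A (lam^-1 ^+ 2).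
have AB y : y \in B -> y \in A := fsubsetP BA y.
have AE y : y \in E -> y \in A by move=> yE; apply/AB/(fsubsetP EB).
have row2 x : dil_dgroup A (lam^-1 ^+ 2) (lam * x) <-> dil_dgroup A lam^-1 x.
  by rewrite /dil_dgroup expr2 mulrA mulfVK.
(* The [l] in [L] for which [E] meets the class of [x0 + lam * l] modulo [lam^2 L]. The aim is that
   [T] exhausts [L]. *)
pose T l := dgroup A l /\ exists2 x, x \in E & dil_dgroup A (lam^-1 ^+ 2) (x - x0 - lam * l).
have T0 : T 0.
  by split; [exact: sA.1|exists x0 => //; rewrite mulr0 subr0 subrr; exact: s2.1].
have Tinv l m : T l -> dgroup A m -> dil_dgroup A lam^-1 m -> T (l + m).
  move=> [lA [x xE xl]] mA m1; split; first exact: (subgrpD sA lA mA).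
  exists x => //; rewrite (_ : _ - _ = (x - x0 - lam * l) - lam * m); last by ring.
  by apply: s2.2 => //; apply/row2.
have [closed|] := pselect (forall l y, T l -> y \in B -> T (l + (y - x0))); last first.
  move=> /existsNP[l /existsNP[y /not_implyP[Tl /not_implyP[yB nT]]]]; right; exists y => //.
  have [lA [x xE xl]] := Tl.
  pose By := [fset y' in B | `[< dil_dgroup A lam^-1 (y' - y) >]].
  have ByP y' : y' \in By -> y' \in B /\ dil_dgroup A lam^-1 (y' - y).
    by rewrite !inE /= => /andP[? /asboolP].
  (* If some [x + lam * y'] were [x'' + lam * y''] with both points in [E], then [x''] would put
     [l + (y - x0)] into [T]; hence all of [W] is new. *)
  pose W := [fset x + lam * y' | y' in By].
  have cW : #|` W| = #|` By| by rewrite card_imfset // => a b /addrI/(mulfI lam0).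
  have dis : addf E (dilf lam E) `&` W = fset0.
    apply/eqP; rewrite -fsubset0; apply/fsubsetP => z; rewrite in_fsetI => /andP[].
    move=> /addfP[x'' [v [x''E /dilfP[y'' y''E ->] ->]]].
    move=> /imfsetP[y' /= /ByP[y'B y'y] e]; case: nT; split.
      by apply: (subgrpD sA lA); apply: dgroupB; [apply: AB|apply: AE].
    exists x'' => //.
    have -> : x'' - x0 - lam * (l + (y - x0)) =
        (x - x0 - lam * l) + lam * ((y' - y) - (y'' - x0)).
      by rewrite -[x''](addrK (lam * y'')) e; ring.
    by apply: (subgrpD s2 xl); apply/row2; apply: s1.2 => //; apply: Erow.
  rewrite -/By -cW -cardfsUI dis cardfs0 addn0.
  apply: fsubset_leq_card; apply/fsubsetP => z; rewrite in_fsetU => /orP[].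
    by apply: (fsubsetP (addfS (fsubset_refl _) (dilfS lam EB))).
  by move=> /imfsetP[y' /= /ByP[y'B _] ->]; rewrite mem_addf // mem_dilf.
left => l lA.
have closedn l' y n : T l' -> y \in B -> T (l' + (y - x0) *+ n).
  move=> Tl' yB; elim: n => [|n IHn]; first by rewrite mulr0n addr0.
  by rewrite mulrSr addrA; apply: closed.
(* [E] is finite, so forward translates repeat; backward translation is then a forward one modulo
   [lam L]. *)
have closedN l' y : T l' -> y \in B -> T (l' - (y - x0)).
  move=> Tl' yB; have gA : dgroup A (y - x0) by apply: dgroupB; [apply: AB|apply: AE].
  have /choice[f fP] : forall n, exists x, x \in E /\
      dil_dgroup A (lam^-1 ^+ 2) (x - x0 - lam * (l' + (y - x0) *+ n)).
    by move=> n; have [_ [x xE xn]] := closedn l' y n Tl' yB; exists x.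
  have [m [m' [mm' fmm']]] : exists m m', (m < m')%N /\ f m = f m'.
    apply: contrapT => nex; have := @leq_card_inj _ _ f [fset m in iota 0 #|` E|.+1] E.
    rewrite card_fseq undup_id ?iota_uniq // size_iota ltnn => h.
    suff: false by []. apply: h => [m m' _ _ e|m _]; last by have [] := fP m.
    have [lt|lt|//] := ltngtP m m'; case: nex; first by exists m, m'.
    by exists m', m.
  have gm : dil_dgroup A lam^-1 ((y - x0) *+ (m' - m)).
    apply/row2; have [_ h] := fP m; have [_ h'] := fP m'.
    have -> : lam * ((y - x0) *+ (m' - m)) =
      (f m - x0 - lam * (l' + (y - x0) *+ m)) - (f m' - x0 - lam * (l' + (y - x0) *+ m')).
      by rewrite fmm' mulrnBr ?(ltnW mm') //; ring.
    exact: s2.2.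
  have -> : l' - (y - x0) = (l' + (y - x0) *+ (m' - m).-1) - (y - x0) *+ (m' - m).
    by rewrite -[in X in _ = _ - X](prednK (_ : 0 < m' - m)%N) ?subn_gt0 // mulrSr; ring.
  apply: Tinv; first exact: closedn.
    apply: (subgrpN sA); elim: (m' - m)%N => [|n IHn]; first exact: sA.1.
    by rewrite mulrSr; apply: (subgrpD sA).
  exact: (subgrpN s1).
(* The stabiliser of [T] is a subgroup containing all differences of [A], hence all of [L]. *)
pose H m := dgroup A m /\ forall l', T l' -> T (l' + m) /\ T (l' - m).
suff /(_ 0 T0)[] : forall l', T l' -> T (l' + l) /\ T (l' - l).
  by rewrite add0r => -[_ ?].
have [_ //] : H l; apply: lA.
  split; first by split; [exact: sA.1|move=> l'; rewrite addr0 subr0].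
  move=> a b [aA Ha] [bA Hb]; split; first exact: sA.2.
  move=> l' Tl'; split.
    by rewrite addrA; apply: (Hb _ _).2; apply: (Ha _ _).1.
  by rewrite opprB addrCA addrC; apply: (Hb _ _).1; apply: (Ha _ _).2.
move=> a b aA bA; split; first exact: dgroupB.
have [y yB ay] := Brows _ aA; have [y' y'B by'] := Brows _ bA.
have abA : dgroup A (a - b - (y - y')).
  by apply: sA.2; apply: dgroupB => //; apply: AB.
have ab1 : dil_dgroup A lam^-1 (a - b - (y - y')).
  rewrite (_ : _ - _ = (a - y) - (b - y')); last by ring.
  exact: s1.2.
move=> l' Tl'; split.
  rewrite (_ : l' + (a - b) = (l' + (y - x0) - (y' - x0)) + (a - b - (y - y'))); last by ring.
  by apply: Tinv => //; apply: closedN => //; apply: closed.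
rewrite (_ : l' - (a - b) = (l' + (y' - x0) - (y - x0)) + - (a - b - (y - y'))); last by ring.
by apply: Tinv; [apply: closedN => //; apply: closed|apply: (subgrpN sA)|apply: (subgrpN s1)].
Qed.
End DifferenceGroup.

(** * Concavity and evenly distributed cells *)

Section Numeric.
Variable R : realType.

Lemma sumr_const_seq (T : Type) (I : seq T) (x : R) : \sum_(i <- I) x = (size I)%:R * x.
Proof. by rewrite big_const_seq count_predT iter_addr_0 mulr_natl. Qed.

(** Each term lies below the tangent of the concave power at the mean (Bernoulli, from Young's
    inequality), and the tangents add up to the right-hand side. *)
Lemma sum_powR (T : eqType) (I : seq T) (s : T -> R) (sig : R) : 0 < sig -> sig < 1 ->
  (forall i, 0 <= s i) ->
  \sum_(i <- I) s i `^ (1 - sig) <= (size I)%:R `^ sig * (\sum_(i <- I) s i) `^ (1 - sig).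
Proof.
move=> sig0 sig1 s0; set S := \sum_(i <- I) s i.
have S_ge0 : 0 <= S by apply: sumr_ge0.
have o0 : 0 < 1 - sig by rewrite subr_gt0.
have [S0|] := eqVneq S 0.
  rewrite big_seq big1 ?mulr_ge0 ?powR_ge0 // => i iI.
  suff -> : s i = 0 by rewrite powR0 // gt_eqF.
  apply/eqP; rewrite eq_le s0 andbT -S0 /S (big_rem i iI) /= lerDl.
  exact: sumr_ge0.
rewrite neq_lt ltNge S_ge0 /= => Sgt0.
have k0 : (0 : R) < (size I)%:R.
  rewrite ltr0n lt0n size_eq0; apply: contraTN Sgt0 => /eqP I0.
  by rewrite /S I0 big_nil ltxx.
pose k : R := (size I)%:R.
have bern u : 0 <= u -> u `^ (1 - sig) <= (1 - sig) * u + sig.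
  move=> u0; have := @conjugate_powR R (u `^ (1 - sig)) 1 (1 - sig)^-1 sig^-1.
  rewrite powR_ge0 ler01 !invr_gt0 o0 sig0 !invrK subrK mulr1 powR1 mul1r.
  rewrite -powRrM mulfV ?gt_eqF // powRr1 // => /(_ isT isT isT isT erefl).
  by rewrite mulrC.
have a0 : 0 < S / k by rewrite divr_gt0.
have -> : (size I)%:R `^ sig * S `^ (1 - sig) = \sum_(i <- I) (S / k) `^ (1 - sig) *
    ((1 - sig) * (s i / (S / k)) + sig).
  rewrite -mulr_sumr big_split /= -mulr_sumr -mulr_suml -/S sumr_const_seq -/k.
  have -> : S / (S / k) = k by field; rewrite !gt_eqF.
  rewrite [k * sig]mulrC -mulrDl subrK mul1r -[S in LHS](divfK (lt0r_neq0 k0)) -/k.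
  rewrite (@powRM _ (S / k) k) ?(ltW a0) ?(ltW k0) // mulrCA -powRD ?(gt_eqF k0) ?implybT //.
  by have -> : sig + (1 - sig) = 1 by [ring]; rewrite powRr1 ?(ltW k0).
apply: ler_sum => i _.
have {1}-> : s i = (S / k) * (s i / (S / k)) by rewrite mulrCA mulfV ?mulr1 ?gt_eqF.
rewrite (powRM _ (ltW a0)) ?divr_ge0 ?(ltW a0) //.
by rewrite ler_wpM2l ?powR_ge0 // bern // divr_ge0 // ltW.
Qed.

(** [m] is the least density and [y] lists the densities on the other side. In the sum over [J] the
    multiples of [c] cancel, leaving the total excess of [y] over [m], which is at most [g]. *)
Lemma even_min (T : eqType) (J : seq T) (P Q c m N g : R) (f s y : T -> R) :
  0 < Q -> 0 < P -> 1 <= Q -> Q = (size J)%:R ->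
  {in J, forall b, c * m + (y b - m) <= f b} ->
  \sum_(b <- J) s b = Q * m -> P * \sum_(b <- J) y b = N ->
  \sum_(b <- J) Num.max 0 (f b - c * s b) <= g -> N / (P * Q) - g <= m.
Proof.
move=> Q0 P0 Q1 QJ fP sm yN gP.
have : \sum_(b <- J) (c * m + (y b - m) - c * s b) <= g.
  apply: le_trans gP; rewrite big_seq [leRHS]big_seq; apply: ler_sum => b bJ.
  by rewrite le_max lerB ?fP ?orbT.
have g0 : 0 <= g by apply: le_trans gP; apply: sumr_ge0 => b _; rewrite le_max lexx.
rewrite sumrB big_split /= sumrB -[X in _ - X <= _]mulr_sumr sm !sumr_const_seq -QJ -yN.
set S := \sum_(b <- J) y b => h.
have -> : P * S / (P * Q) = S / Q by field; rewrite !gt_eqF.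
rewrite lerBlDl -lerBlDr -(ler_pM2l Q0) mulrBr mulrCA mulfV ?gt_eqF // mulr1.
by nra.
Qed.

(* If the smallest of the densities [X a / Q'] and [Y b / P'] is [X a0 / Q'], then
   summing [bm d (X a0) (Y b) - c * s a0 b] over [b] bounds the defect of that density
   from the mean by [g]. So a small [g] forces an even distribution, and a large [g] is
   a gain over the inductive bounds [c * s a b - psi a b]. *)
Lemma even_bounds (T : choiceType) (I J : seq T) (d : nat) (P Q : R) (X Y : T -> R)
    (s t psi : T -> T -> R) (N e : R) :
  let P' : R := (size I)%:R in let Q' : R := (size J)%:R in let c := bm d Q P in
  let g := \sum_(a <- I) \sum_(b <- J) Num.max 0 (bm d (X a) (Y b) - c * s a b) in
  (0 < d)%N -> 1 <= P -> 1 <= Q -> P <= P' -> Q <= Q' -> 0 <= e ->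
  (forall a, 0 <= X a) -> (forall b, 0 <= Y b) -> (forall a b, 0 <= psi a b) ->
  {in I, forall a, \sum_(b <- J) s a b = X a} ->
  {in J, forall b, \sum_(a <- I) s a b = Y b} ->
  \sum_(a <- I) X a = N ->
  {in I & J, forall a b, bm d (X a) (Y b) <= t a b + e} ->
  \sum_(a <- I) \sum_(b <- J) t a b >= c * N - c * P' * Q' * g - P' * Q' * e /\
  ({in I & J, forall a b, c * s a b - psi a b <= t a b} ->
   \sum_(a <- I) \sum_(b <- J) t a b >=
     c * N - \sum_(a <- I) \sum_(b <- J) psi a b + g - P' * Q' * e).
Proof.
move=> P' Q' c g d0 P1 Q1 PP' QQ' e0 X0 Y0 psi0 sX sY XN tf.
have P'1 : 1 <= P' := le_trans P1 PP'; have Q'1 : 1 <= Q' := le_trans Q1 QQ'.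
have P'0 : 0 < P' by apply: lt_le_trans P'1. have Q'0 : 0 < Q' by apply: lt_le_trans Q'1.
have c0 : 0 <= c := bm_ge0 _ _ _.
have YN : \sum_(b <- J) Y b = N.
  rewrite -XN big_seq; under eq_bigr => b bJ do rewrite -(sY b bJ).
  rewrite -big_seq exchange_big big_seq [RHS]big_seq.
  by apply: eq_bigr => a aI; rewrite sX.
have sum_e h : \sum_(a <- I) \sum_(b <- J) (h a b - e) =
    \sum_(a <- I) \sum_(b <- J) h a b - P' * Q' * e.
  under eq_bigr do rewrite sumrB sumr_const_seq.
  by rewrite sumrB sumr_const_seq -/P' -/Q'; ring.
have sN : \sum_(a <- I) \sum_(b <- J) s a b = N.
  by rewrite -XN big_seq [RHS]big_seq; apply: eq_bigr => a aI; rewrite sX.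
(* Both families have mean [N / (P' * Q')], and equal densities [m] give
   [bm d (Q' * m) (P' * m) >= c * m]. *)
pose x a := X a / Q'; pose y b := Y b / P'.
have x0 a : 0 <= x a by rewrite divr_ge0 // ltW.
have y0 b : 0 <= y b by rewrite divr_ge0 // ltW.
have Xx a : X a = Q' * x a by rewrite /x mulrCA mulfV ?mulr1 // gt_eqF.
have Yy b : Y b = P' * y b by rewrite /y mulrCA mulfV ?mulr1 // gt_eqF.
have cle m : 0 <= m -> c * m <= bm d (Q' * m) (P' * m).
  move=> m0; rewrite ![_ * m]mulrC bmZ // ?(ltW P'0) ?(ltW Q'0) //.
  by rewrite ler_wpM2l // le_bm // (le_trans ler01).
have f_y a b : x a <= y b -> c * x a + (y b - x a) <= bm d (X a) (Y b).
  move=> xy; have h0 : 0 <= y b - x a by rewrite subr_ge0.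
  rewrite Xx Yy; have -> : P' * y b = P' * x a + P' * (y b - x a) by ring.
  apply: le_trans (bm_addr _ _ _ _) => //; try by rewrite mulr_ge0 // ltW.
  by rewrite lerD ?cle // ler_peMl.
have f_x a b : y b <= x a -> c * y b + (x a - y b) <= bm d (X a) (Y b).
  move=> xy; have h0 : 0 <= x a - y b by rewrite subr_ge0.
  rewrite Xx Yy bmC; have -> : Q' * x a = Q' * y b + Q' * (x a - y b) by ring.
  apply: le_trans (bm_addr _ _ _ _) => //; try by rewrite mulr_ge0 // ltW.
  by rewrite bmC lerD ?cle // ler_peMl.
have gI a : a \in I -> \sum_(b <- J) Num.max 0 (bm d (X a) (Y b) - c * s a b) <= g.
  move=> aI; rewrite /g (big_rem a aI) /= lerDl; apply: sumr_ge0 => a' _.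
  by apply: sumr_ge0 => b _; rewrite le_max lexx.
have gJ b : b \in J -> \sum_(a <- I) Num.max 0 (bm d (X a) (Y b) - c * s a b) <= g.
  move=> bJ; rewrite /g exchange_big (big_rem b bJ) /= lerDl; apply: sumr_ge0 => b' _.
  by apply: sumr_ge0 => a _; rewrite le_max lexx.
pose m0 := N / (P' * Q') - g.
have argmin (K : seq T) (h : T -> R) : (0 : R) < (size K)%:R ->
    exists2 k, k \in K & {in K, forall k', h k <= h k'}.
  move=> K0; have [|k] := @fset_argmax T R (fun z => - h z) [fset z in K].
    case: K K0 => [|z K]; first by rewrite ltxx.
    by move=> _; apply/fset0Pn; exists z; rewrite !inE eqxx.
  rewrite !inE /= => kK kP; exists k => // k' k'K; rewrite -lerN2.
  by apply: kP; rewrite !inE.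
have [a0 a0I a0P] := argmin I x P'0; have [b0 b0J b0P] := argmin J y Q'0.
have m0P : {in I & J, forall a b, m0 <= x a /\ m0 <= y b}.
  move=> a b aI bJ; have [xy|yx] := leP (x a0) (y b0).
    suff m0x : m0 <= x a0.
      by split; apply: (le_trans m0x); [apply: a0P|apply: (le_trans xy); apply: b0P].
    apply: (@even_min T J P' Q' c (x a0) N g (fun b => bm d (X a0) (Y b)) (s a0) y) => //.
    - by move=> b' b'J; apply: f_y; apply: (le_trans xy); apply: b0P.
    - by rewrite sX // -Xx.
    - by rewrite -YN mulr_sumr; apply: eq_bigr => b' _; rewrite -Yy.
    - exact: gI.
  suff m0y : m0 <= y b0.
    by split; apply: (le_trans m0y); [apply: (le_trans (ltW yx)); apply: a0P|apply: b0P].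
  rewrite /m0 [P' * Q']mulrC.
  apply: (@even_min T I Q' P' c (y b0) N g (fun a => bm d (X a) (Y b0)) (s^~ b0) x) => //.
  - by move=> b' b'J; apply: f_x; apply: (le_trans (ltW yx)); apply: a0P.
  - by rewrite sY // -Yy.
  - by rewrite -XN mulr_sumr; apply: eq_bigr => b' _; rewrite -Xx.
  - exact: gJ.
have fm0 : {in I & J, forall a b, c * m0 <= bm d (X a) (Y b)}.
  move=> a b aI bJ; have [m0x m0y] := m0P a b aI bJ.
  have [xy|/ltW yx] := leP (x a) (y b).
    by apply: le_trans (f_y _ _ xy); rewrite ler_wpDr ?subr_ge0 // ler_wpM2l.
  by apply: le_trans (f_x _ _ yx); rewrite ler_wpDr ?subr_ge0 // ler_wpM2l.
split=> [|tpsi].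
  apply: (@le_trans _ _ (\sum_(a <- I) \sum_(b <- J) (c * m0 - e))).
    rewrite sum_e !sumr_const_seq -/P' -/Q' /m0.
    rewrite le_eqVlt; apply/orP; left; apply/eqP.
    by field; rewrite !gt_eqF.
  rewrite big_seq [leRHS]big_seq; apply: ler_sum => a aI.
  rewrite big_seq [leRHS]big_seq; apply: ler_sum => b bJ.
  by rewrite lerBlDr (le_trans (fm0 a b aI bJ)) ?tf.
(* Termwise below [t a b] by whichever of its two lower bounds is larger. *)
apply: (@le_trans _ _ (\sum_(a <- I) \sum_(b <- J)
    (c * s a b - psi a b + Num.max 0 (bm d (X a) (Y b) - c * s a b) - e))).
  rewrite sum_e lerB //.
  under [leRHS]eq_bigr do rewrite big_split sumrB -mulr_sumr /=.
  by rewrite big_split sumrB -mulr_sumr /= sN.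
rewrite big_seq [leRHS]big_seq; apply: ler_sum => a aI.
rewrite big_seq [leRHS]big_seq; apply: ler_sum => b bJ.
have := tpsi a b aI bJ; have := tf a b aI bJ; have := psi0 a b.
by have [h|h] := leP 0 (bm d (X a) (Y b) - c * s a b); lra.
Qed.

End Numeric.

(** * Classes of a map and disjoint sums of classes *)

Section Classes.
Variable R : realType.
Implicit Types (A B E X Y : {fset R}) (f g : R -> R) (lam mu : R).
Local Notation card A := (#|` A|%:R : R).

Lemma sum_disjoint (T : eqType) (V : choiceType) (I : seq T) (W : T -> {fset V}) (Z : {fset V}) :
  uniq I -> {in I, forall i, W i `<=` Z} ->
  {in I &, forall i j, i != j -> W i `&` W j = fset0} ->
  (\sum_(i <- I) #|` W i| <= #|` Z|)%N.
Proof.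
elim: I Z => [|i I IHI] Z /=; first by rewrite big_nil.
move=> /andP[iI uI] WZ dis; rewrite big_cons -(cardfsID (W i) Z).
have -> : Z `&` W i = W i by apply/fsetIidPr/WZ; rewrite mem_head.
rewrite leq_add2l; apply: IHI => // [j jI|j k jI kI].
  rewrite fsubsetD WZ ?in_cons ?jI ?orbT //= -fsetI_eq0 dis ?eqxx ?in_cons ?eqxx ?jI ?orbT //.
  by apply: contraNN iI => /eqP <-.
by apply: dis; rewrite in_cons ?jI ?kI orbT.
Qed.

Definition cls f A (i : R) : {fset R} := [fset x in A | f x == i].

Lemma in_cls f A i x : (x \in cls f A i) = (x \in A) && (f x == i).
Proof. by rewrite !inE. Qed.

Lemma cls_sub f A i : cls f A i `<=` A.
Proof. by apply/fsubsetP => x; rewrite in_cls => /andP[]. Qed.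

Lemma clsC f g A i j : cls f (cls g A j) i = cls g (cls f A i) j.
Proof. by apply/fsetP => x; rewrite !in_cls andbAC. Qed.

Lemma cls_neq0 f A i : i \in f @` A -> cls f A i != fset0.
Proof.
by move=> /imfsetP[x /= xA ->]; apply/fset0Pn; exists x; rewrite in_cls xA eqxx.
Qed.

Lemma sum_cls f A (I : {fset R}) : {in A, forall x, f x \in I} ->
  \sum_(i <- I) card (cls f A i) = card A.
Proof.
move=> fI; rewrite (card_partition f A) natr_sum; apply/esym/big_fset_incl.
  by apply/fsubsetP => _ /imfsetP[x /= xA ->]; apply: fI.
move=> i _ iA /=; rewrite -/(cls f A i); suff -> : cls f A i = fset0 by rewrite cardfs0.
apply/eqP; rewrite -fsubset0; apply/fsubsetP => x; rewrite in_cls => /andP[xA /eqP fx].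
by case/negP: iA; apply/imfsetP; exists x.
Qed.

Lemma sum_targets f g lam X Y :
  {in X &, forall x x', {in Y &, forall y y',
    x + lam * y = x' + lam * y' -> f x = f x' /\ g y = g y'}} ->
  \sum_(i <- f @` X) \sum_(j <- g @` Y) card (addf (cls f X i) (dilf lam (cls g Y j)))
    <= card (addf X (dilf lam Y)).
Proof.
move=> inj; under eq_bigr do rewrite -natr_sum; rewrite -natr_sum ler_nat.
pose W (p : R * R) := addf (cls f X p.1) (dilf lam (cls g Y p.2)).
have := @big_allpairs _ 0%N addn _ _ (f @` X) (g @` Y) (fun p => #|` W p|) => /= <-.
apply: sum_disjoint => [|[i j] _|[i j] [i' j'] _ _ ne] /=.
- by apply: allpairs_uniq; rewrite ?fset_uniq // => -[? ?] [? ?] _ _ [-> ->].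
- by apply: addfS; [exact: cls_sub|apply: dilfS; exact: cls_sub].
apply/eqP; rewrite -fsubset0; apply/fsubsetP => z; rewrite in_fsetI => /andP[].
move=> /addfP[x [_ [xX /dilfP[y yY ->] ->]]] /addfP[x' [_ [x'X /dilfP[y' y'Y ->] e]]].
move: xX yY x'X y'Y; rewrite !in_cls /=.
move=> /andP[xX /eqP fx] /andP[yY /eqP gy] /andP[x'X /eqP fx'] /andP[y'Y /eqP gy'].
have [ff gg] := inj x x' xX x'X y y' yY y'Y e.
by case/negP: ne; rewrite -fx -gy -fx' -gy' ff gg.
Qed.

(** [sum_targets] with a constant map on [Y]: the classes of [X] have disjoint sums with [lam Y],
    each of size at least [|Y|]. *)
Lemma card_classes f lam X Y : lam != 0 -> X != fset0 -> Y != fset0 ->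
  {in X &, forall x x', {in Y &, forall y y', x + lam * y = x' + lam * y' -> f x = f x'}} ->
  card (f @` X) * card Y <= card (addf X (dilf lam Y)).
Proof.
move=> lam0 X0 Y0 inj.
have YE : (fun=> 0) @` Y = [fset 0] :> {fset R}.
  apply/fsetP => x; rewrite !inE; apply/imfsetP/eqP => [[y _ ->]//|->].
  by have /fset0Pn[y yY] := Y0; exists y.
have inj' : {in X &, forall x x', {in Y &, forall y y',
    x + lam * y = x' + lam * y' -> f x = f x' /\ (0 : R) = 0}}.
  by move=> x x' xX x'X y y' yY y'Y e; split=> //; exact: inj e.
apply: le_trans (sum_targets inj'); rewrite YE.
rewrite -sumr_const_seq big_seq [leRHS]big_seq; apply: ler_sum => i iX.
rewrite big_seq_fset1 ler_nat.
have -> : cls (fun=> 0) Y 0 = Y by apply/fsetP => x; rewrite in_cls eqxx andbT.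
rewrite -(card_dilf Y lam0).
by apply: leq_card_addfr; apply: cls_neq0.
Qed.

(** Carries bounds for [lam^-1] back to [lam], with the summands exchanged. *)
Lemma card_addf_dilV lam X Y : lam != 0 ->
  #|` addf X (dilf lam^-1 Y)| = #|` addf Y (dilf lam X)|.
Proof.
move=> lam0; rewrite -(card_dilf _ lam0) dilfD dilf_dilf mulfV // dilf1 addfC //.
Qed.

End Classes.

(** * Rows, columns, subrows and subcolumns *)

Section Rows.
Variable R : realType.
Implicit Types (A B E X Y : {fset R}) (lam mu : R).
Local Notation card A := (#|` A|%:R : R).

Definition crep A mu := coset_rep (dil_dgroup A mu).

Lemma crepP A mu x y : crep A mu x = crep A mu y <-> dil_dgroup A mu (x - y).
Proof. by apply: coset_rep_eq; apply: subgrp_dil_dgroup. Qed.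

Lemma row_eq lam A a a' b b' : lam != 0 -> b \in A -> b' \in A ->
  a + lam * b = a' + lam * b' -> crep A lam^-1 a = crep A lam^-1 a'.
Proof.
move=> lam0 bA b'A e; apply/crepP; rewrite /dil_dgroup.
have -> : a - a' = lam * (b' - b) by rewrite -[a](addrK (lam * b)) e; ring.
by rewrite mulKf //; apply: dgroupB.
Qed.

Lemma col_eq lam A a a' b b' : a \in A -> a' \in A ->
  a + lam * b = a' + lam * b' -> crep A lam b = crep A lam b'.
Proof.
move=> aA a'A e; apply/crepP; rewrite /dil_dgroup.
have -> : lam * (b - b') = a' - a by rewrite -[a'](addrK (lam * b')) -e; ring.
exact: dgroupB.
Qed.

(** Here [b' - b] lies in [lam L], not merely in [L], so [a - a'] lies in [lam^2 L]: with [b]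
    confined to one row, sums separate even subrows. *)
Lemma row2_eq lam A a a' b b' : lam != 0 -> crep A lam^-1 b = crep A lam^-1 b' ->
  a + lam * b = a' + lam * b' -> crep A (lam^-1 ^+ 2) a = crep A (lam^-1 ^+ 2) a'.
Proof.
move=> lam0 /esym/crepP bb e; apply/crepP; rewrite /dil_dgroup.
have -> : a - a' = lam * (b' - b) by rewrite -[a](addrK (lam * b)) e; ring.
by rewrite expr2 -mulrA mulKf.
Qed.

Lemma col2_eq lam A a a' b b' : crep A lam a = crep A lam a' ->
  a + lam * b = a' + lam * b' -> crep A (lam ^+ 2) b = crep A (lam ^+ 2) b'.
Proof.
move=> /esym/crepP aa e; apply/crepP; rewrite /dil_dgroup expr2 -mulrA.
by have -> : lam * (b - b') = a' - a by rewrite -[a'](addrK (lam * b')) -e; ring.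
Qed.

Lemma card_rows lam A : lam != 0 -> A != fset0 ->
  card (crep A lam^-1 @` A) * card A <= card (addf A (dilf lam A)).
Proof.
move=> lam0 A0; apply: card_classes => // x x' _ _ y y' yA y'A; exact: row_eq.
Qed.

(** Sums of [E] with [lam] times the largest row of [A] separate the subrows of [E], and that row
    has at least the average size. *)
Lemma card_subrows lam A E : lam != 0 -> E != fset0 -> E `<=` A ->
  card (crep A (lam^-1 ^+ 2) @` E) * card A <=
    card (crep A lam^-1 @` A) * card (addf A (dilf lam A)).
Proof.
move=> lam0 E0 EA; set r := crep A lam^-1.
have A0 : A != fset0 by apply: contraNN E0 => /eqP A0; rewrite -fsubset0 -A0.
have [k] := @popular_fiber _ _ r A (r @` A) A0 (fun x xA => in_imfset _ _ xA).
rewrite -/(cls r A k) -(ler_nat R) natrM => kP.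
have k0 : cls r A k != fset0.
  apply: contraTN kP => /eqP ->; rewrite cardfs0 mulr0 -ltNge ltr0n.
  by rewrite lt0n cardfs_eq0.
apply: (@le_trans _ _ (card (r @` A) * (card (crep A (lam^-1 ^+ 2) @` E) * card (cls r A k)))).
  by rewrite mulrCA ler_wpM2l.
rewrite ler_wpM2l //; apply: le_trans (card_classes lam0 E0 k0 _) _.
  move=> x x' _ _ y y'; rewrite !in_cls => /andP[_ /eqP yk] /andP[_ /eqP y'k].
  by apply: row2_eq; rewrite // -/r yk y'k.
by rewrite ler_nat; apply/fsubset_leq_card/addfS => //; apply/dilfS/cls_sub.
Qed.

(** Subtracting [x0] and dividing by [lam] turns the subrow representatives into a set covering [L]
    modulo [lam L], as [index_ge] requires. *)
Lemma index_rows lam p A E x0 : lam != 0 -> is_min_poly_int lam p -> primitive_int_poly p ->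
  (1 < #|` A|)%N ->
  (forall l, dgroup A l -> exists2 x, x \in E & dil_dgroup A (lam^-1 ^+ 2) (x - x0 - lam * l)) ->
  (absz (p`_0)%R <= #|` crep A (lam^-1 ^+ 2) @` E|)%N.
Proof.
move=> lam0 pmin pprim A1 full.
have /fset0Pn[a aA] : A != fset0 by rewrite -cardfs_gt0 ltnW.
have L := dgroup_zspan aA.
pose T := (fun r => lam^-1 * (r - x0)) @` (crep A (lam^-1 ^+ 2) @` E).
apply: (@leq_trans #|` T|); last exact: leq_imfset_card.
apply: (@index_ge _ lam p (fun i => nth a A i - a) #|` A| T pmin pprim).
- have /fset0Pn[b] : A `\ a != fset0.
    by rewrite -cardfs_gt0; move: A1; rewrite (cardfsD1 a) aA.
  rewrite !inE => /andP[ba bA]; exists (index b A); first by rewrite index_mem.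
  by rewrite nth_index // subr_eq0; exact: ba.
- move=> x; rewrite -L => /full[y yE]; set r := crep A (lam^-1 ^+ 2) y => yx.
  exists (lam^-1 * (r - x0)); first by apply/imfsetP; exists r => //; apply: in_imfset.
  have ry := coset_repP y (subgrp_dil_dgroup A (lam^-1 ^+ 2)).
  exists (lam^-1 ^+ 2 * ((y - r) - (y - x0 - lam * x))).
    exact: (subgrp_dil_dgroup A (lam^-1 ^+ 2)).2.
  by field.
Qed.

End Rows.

(** * The induction step *)

Section Step.
Variables (R : realType) (lam : R) (d : nat) (P Q D sig : R).
Hypotheses (lam0 : lam != 0) (d0 : (0 < d)%N) (P1 : 1 <= P) (Q1 : 1 <= Q).
Hypotheses (D0 : 0 <= D) (sig0 : 0 < sig) (sig1 : sig < 1).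
Implicit Types (A B E X Y : {fset R}).
Local Notation card A := (#|` A|%:R : R).
Local Notation c := (bm d Q P).

Lemma bm_ge1 : 1 <= c.
Proof.
apply: le_trans (le_bm d ler01 Q1 (lexx 0) (le_trans ler01 P1)).
rewrite /bm powR1 powR0 ?invr_eq0 ?pnatr_eq0 -?lt0n // addr0 expr1n //.
Qed.

Lemma sum_powR2 (I J : seq R) (s : R -> R -> R) (m : R) : (forall i j, 0 <= s i j) ->
  (size I)%:R * (size J)%:R <= m ->
  \sum_(i <- I) \sum_(j <- J) s i j `^ (1 - sig) <=
    m `^ sig * (\sum_(i <- I) \sum_(j <- J) s i j) `^ (1 - sig).
Proof.
move=> s0 mP; pose S i := \sum_(j <- J) s i j.
have S0 i : 0 <= S i by apply: sumr_ge0.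
apply: (@le_trans _ _ (\sum_(i <- I) (size J)%:R `^ sig * S i `^ (1 - sig))).
  by apply: ler_sum => i _; apply: sum_powR.
rewrite -mulr_sumr.
apply: (@le_trans _ _ ((size J)%:R `^ sig * ((size I)%:R `^ sig * (\sum_(i <- I) S i) `^ (1 - sig)))).
  by rewrite ler_wpM2l ?powR_ge0 //; apply: sum_powR.
rewrite mulrA -powRM // ler_wpM2r ?powR_ge0 // mulrC.
by apply: ge0_ler_powR; rewrite ?nnegrE ?(ltW sig0) ?mulr_ge0 // (le_trans _ mP) ?mulr_ge0.
Qed.

Definition dil_bound X := c * card X - D * card X `^ (1 - sig) <= card (addf X (dilf lam X)).

Lemma dil_bound0 : dil_bound fset0.
Proof.
by rewrite /dil_bound cardfs0 mulr0 sub0r (@le_trans _ _ 0) // oppr_le0 mulr_ge0 ?powR_ge0.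
Qed.

(** The dichotomy for a cell [E] with enough subrows and subcolumns: even distribution gives the
    constant [c] directly, unevenness gives a gain. The cell has at most [c ^+ 4] pieces, whence the
    factor in the inductive loss. *)
Lemma piece_bound A E (e h : R) : E != fset0 -> E `<=` A ->
  let r := crep A (lam^-1 ^+ 2) in let k := crep A (lam ^+ 2) in
  {in E &, forall x y, crep A lam^-1 x = crep A lam^-1 y} ->
  {in E &, forall x y, crep A lam x = crep A lam y} ->
  P <= card (r @` E) <= c ^+ 2 -> Q <= card (k @` E) <= c ^+ 2 ->
  (forall X Y, X != fset0 -> Y != fset0 -> X `<=` A -> Y `<=` A ->
     bm d (card X) (card Y) <= card (addf X (dilf lam Y)) + e) ->
  0 <= e -> 0 < h -> c ^+ 4 * e <= h ->
  (forall X, X `<=` E -> X != E -> dil_bound X) ->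
  c * card E - (2 * c ^+ 5 + 1) * h <= card (addf E (dilf lam E)) \/
  c * card E - D * (c ^+ 4) `^ sig * card E `^ (1 - sig) + h <= card (addf E (dilf lam E)).
Proof.
move=> E0 EA r k Erow Ecol /andP[PI Ic] /andP[QJ Jc] bmE e0 h0 eh IH.
set I := r @` E in PI Ic *; set J := k @` E in QJ Jc *.
have c1 := bm_ge1; have c0 : 0 <= c := bm_ge0 _ _ _.
pose X a := card (cls r E a); pose Y b := card (cls k E b).
pose s a b := card (cls k (cls r E a) b).
pose t a b := card (addf (cls r E a) (dilf lam (cls k E b))).
pose psi a b := D * s a b `^ (1 - sig).
have tE : \sum_(a <- I) \sum_(b <- J) t a b <= card (addf E (dilf lam E)).
  apply: sum_targets => x x' xE x'E y y' yE y'E eq; split.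
    by apply: (row2_eq lam0 _ eq); apply: Erow.
  by apply: (col2_eq _ eq); apply: Ecol.
have clsA f a : cls f E a `<=` A by apply: fsubset_trans (cls_sub _ _ _) EA.
have sX a : a \in I -> \sum_(b <- J) s a b = X a.
  by move=> _; apply: sum_cls => x; rewrite in_cls => /andP[xE _]; apply: in_imfset.
have sY b : b \in J -> \sum_(a <- I) s a b = Y b.
  move=> _; rewrite /s; under eq_bigr do rewrite clsC.
  by apply: sum_cls => x; rewrite in_cls => /andP[xE _]; apply: in_imfset.
have XN : \sum_(a <- I) X a = card E by apply: sum_cls => x xE; apply: in_imfset.
have PQc : card I * card J <= c ^+ 4.
  by rewrite [_ ^+ 4](exprD c 2 2) ler_pM.
have PQe : card I * card J * e <= h by apply: le_trans eh; rewrite ler_wpM2r.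
have [||||] := @even_bounds R _ I J d P Q X Y s t psi (card E) e d0 P1 Q1 PI QJ e0 _ _ _ sX sY XN.
- by move=> a; apply: ler0n.
- by move=> a; apply: ler0n.
- by move=> a b; rewrite mulr_ge0 ?powR_ge0.
- by move=> a b aI bJ; apply: bmE; rewrite ?cls_neq0.
set g := \sum_(a <- I) _; move=> direct gain.
(* The threshold is [2 * h] because the Brunn-Minkowski errors of all pieces together may consume
   one [h]. *)
have [gh|hg] := ltP g (2 * h); [left|right].
  apply: le_trans tE; apply: le_trans direct.
  have : c * (card I * card J) * g <= c * c ^+ 4 * (2 * h).
    rewrite ler_pM ?mulr_ge0 ?ler0n ?(ltW gh) // ?ler_wpM2l //.
    by rewrite sumr_ge0 // => a _; rewrite sumr_ge0 // => b _; rewrite le_max lexx.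
  have -> : c * c ^+ 4 = c ^+ 5 by rewrite -exprS.
  lra.
apply: le_trans tE; apply: (@le_trans _ _ (c * card E - \sum_(a <- I) \sum_(b <- J) psi a b + g
    - card I * card J * e)).
  have -> : \sum_(a <- I) \sum_(b <- J) psi a b =
      D * \sum_(a <- I) \sum_(b <- J) s a b `^ (1 - sig).
    by rewrite mulr_sumr; apply: eq_bigr => a _; rewrite mulr_sumr.
  have sE : \sum_(a <- I) \sum_(b <- J) s a b = card E.
    by rewrite -XN big_seq [RHS]big_seq; apply: eq_bigr => a /sX.
  have := @sum_powR2 I J s (c ^+ 4) (fun a b => ler0n _ _) PQc; rewrite sE.
  move=> /(ler_wpM2l D0); rewrite mulrA; lra.
apply: gain => a b aI bJ; rewrite /psi.
have sub : cls k (cls r E a) b `<=` E by apply: fsubset_trans (cls_sub _ _ _) (cls_sub _ _ _).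
(* Induction does not apply when the piece is the whole of [E]. Then there is one subrow and one
   subcolumn, so [P = Q = 1] and [g = 0], against [hg]. *)
have [EE|ne] := eqVneq (cls k (cls r E a) b) E; last first.
  have := IH _ sub ne; rewrite /dil_bound => /le_trans; apply.
  rewrite ler_nat; apply/fsubset_leq_card/addfS; first exact: cls_sub.
  by apply: dilfS; rewrite clsC; apply: cls_sub.
have EP x : x \in E -> r x = a /\ k x = b.
  by rewrite -{1}EE !in_cls => /andP[/andP[_ /eqP ?] /eqP ?].
have IE : I = [fset a].
  apply/fsetP => z; rewrite !inE; apply/imfsetP/eqP => [[x /= /EP[? _] -> //]|->].
  by have /fset0Pn[x xE] := E0; exists x => //; have [] := EP _ xE.
have JE : J = [fset b].
  apply/fsetP => z; rewrite !inE; apply/imfsetP/eqP => [[x /= /EP[_ ?] -> //]|->].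
  by have /fset0Pn[x xE] := E0; exists x => //; have [] := EP _ xE.
have rE : cls r E a = E.
  by apply/fsetP => x; rewrite in_cls; apply: andb_idr => /EP[/eqP].
have kE : cls k E b = E.
  by apply/fsetP => x; rewrite in_cls; apply: andb_idr => /EP[_ /eqP].
have PE : P = 1 by apply/le_anti; rewrite P1 andbT; move: PI; rewrite IE cardfs1.
have QE : Q = 1 by apply/le_anti; rewrite Q1 andbT; move: QJ; rewrite JE cardfs1.
suff g0 : g = 0 by move: hg; rewrite g0 leNgt mulr_gt0.
rewrite /g IE JE !big_seq_fset1 /X /Y /s rE kE.
rewrite -[X in bm d X X]mulr1 bmZ // PE QE mulrC subrr maxxx //.
Qed.

Lemma full_or_gain mu A B E x0 (h : R) : mu != 0 -> 0 < h -> x0 \in E -> E `<=` B -> B `<=` A ->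
  {in E, forall x, crep A mu^-1 x = crep A mu^-1 x0} ->
  {in A, forall y, h <= card (cls (crep A mu^-1) B (crep A mu^-1 y))} ->
  (forall l, dgroup A l -> exists2 x, x \in E & dil_dgroup A (mu^-1 ^+ 2) (x - x0 - mu * l)) \/
  card (addf E (dilf mu E)) + h <= card (addf E (dilf mu B)).
Proof.
move=> mu0 h0 x0E EB BA Erow Bh.
have [||full|[y yB yP]] := subclasses_full mu0 x0E EB BA; [| |by left|right].
- by move=> x xE; apply/crepP; apply: Erow.
- move=> y yA; have /fset0Pn[y'] : cls (crep A mu^-1) B (crep A mu^-1 y) != fset0.
    by rewrite -cardfs_eq0 -(pnatr_eq0 R) gt_eqF // (lt_le_trans h0) // Bh.
  by rewrite in_cls => /andP[y'B /eqP e]; exists y' => //; apply/crepP.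
move: yP; rewrite -(ler_nat R) natrD; apply: le_trans; rewrite lerD2l.
apply: le_trans (Bh y (fsubsetP BA _ yB)) _; rewrite ler_nat; apply: fsubset_leq_card.
apply/fsubsetP => x; rewrite in_cls !inE /= => /andP[-> /eqP e] /=.
by apply/asboolP/crepP.
Qed.

(** [G] is the permitted loss and [h] the unit of gain. Splitting into at most [c ^+ 2] cells of at
    most [c ^+ 4] pieces inflates the inductive loss to at most [(c ^+ 6) ^ sig * G <= G + h], so
    one gain of [h] suffices. *)
Lemma dil_bound_step p A (e eta : R) : is_min_poly_int lam p -> primitive_int_poly p ->
  P = (absz (p`_0)%R)%:R -> Q = (absz (lead_coef p))%:R -> 
  let G := D * card A `^ (1 - sig) in let h := eta * G in
  (1 < #|` A|)%N -> card (addf A (dilf lam A)) <= c * card A -> G <= c * card A ->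
  (forall X Y, X != fset0 -> Y != fset0 -> X `<=` A -> Y `<=` A ->
     bm d (card X) (card Y) <= card (addf X (dilf lam Y)) + e) ->
  0 <= e -> 0 < eta -> 0 < D -> c ^+ 4 * e <= h -> (c ^+ 6) `^ sig <= 1 + eta ->
  2 * c ^+ 3 * (c + 1) * eta <= 1 -> c ^+ 2 * (2 * c ^+ 5 + 1) * eta <= 1 ->
  (forall X, X `<=` A -> X != A -> dil_bound X) -> dil_bound A.
Proof.
move=> pmin pprim PE QE G h A1 small Gn bmA e0 eta0 Dgt0 eh c6 eta1 eta2 IH.
have A0 : A != fset0 by rewrite -cardfs_gt0 ltnW.
have c1 := bm_ge1; have c0 : 0 < c by apply: lt_le_trans c1.
have cX m : 0 <= c ^+ m := exprn_ge0 m (ltW c0).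
pose n := card A; have n0 : 0 < n by rewrite ltr0n cardfs_gt0.
have G0 : 0 < G by rewrite mulr_gt0 // powR_gt0.
have h0 : 0 < h by rewrite mulr_gt0.
have hE : h = eta * G by []. have GE : G = D * card A `^ (1 - sig) by [].
clearbody h; clearbody G.
have lamV0 : lam^-1 != 0 by rewrite invr_eq0.
have symA : #|` addf A (dilf lam^-1 A)| = #|` addf A (dilf lam A)| by apply: card_addf_dilV.
pose r := crep A lam^-1; pose k := crep A lam.
pose I := r @` A; pose J := k @` A.
pose s i j := card (cls k (cls r A i) j).
pose t i j := card (addf (cls r A i) (dilf lam (cls k A j))).
pose M := D * (c ^+ 4) `^ sig.
have Ic : card I <= c.
  rewrite -(ler_pM2r n0); apply: le_trans small; exact: card_rows.
have Jc : card J <= c.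
  rewrite -(ler_pM2r n0); apply: le_trans small; rewrite -symA.
  by have := card_rows lamV0 A0; rewrite invrK.
have IJc : card I * card J <= c ^+ 2 by rewrite expr2 ler_pM.
have tA : \sum_(i <- I) \sum_(j <- J) t i j <= card (addf A (dilf lam A)).
  apply: sum_targets => x x' xA x'A y y' yA y'A eq.
  by split; [apply: row_eq eq|apply: col_eq eq].
have sX i : \sum_(j <- J) s i j = card (cls r A i).
  by apply: sum_cls => x; rewrite in_cls => /andP[xA _]; apply: in_imfset.
have sn : \sum_(i <- I) \sum_(j <- J) s i j = n.
  under eq_bigr do rewrite sX.
  by apply: sum_cls => x xA; apply: in_imfset.
have t_ge i j : i \in I -> j \in J -> [/\ card (cls r A i) <= t i j, card (cls k A j) <= t i j &
    t i j <= card (addf A (dilf lam A))].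
  move=> iI jJ; split; rewrite ler_nat.
  - apply: leq_card_addfl; rewrite -cardfs_eq0 card_dilf // cardfs_eq0; exact: cls_neq0.
  - by rewrite -(card_dilf _ lam0); apply: leq_card_addfr; apply: cls_neq0.
  - by apply/fsubset_leq_card/addfS; [exact: cls_sub|exact/dilfS/cls_sub].
have DM x : 0 <= x -> D * x <= M * x.
  move=> x0; rewrite ler_wpM2r // ler_peMr // -[leLHS](@powRr0 _ (c ^+ 4)).
  by apply: ler_powR; rewrite ?(ltW sig0) // exprn_ege1.
have cell_t i j : card (addf (cls k (cls r A i) j) (dilf lam (cls k (cls r A i) j))) <= t i j.
  rewrite ler_nat; apply/fsubset_leq_card/addfS; first exact: cls_sub.
  by apply: dilfS; rewrite clsC; apply: cls_sub.
have cellA i j : cls k (cls r A i) j `<=` A.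
  by apply: fsubset_trans (cls_sub _ _ _) (cls_sub _ _ _).
(* The other cells use the induction hypothesis. A cell equal to [A] is the only one, hence is the
   gaining cell itself. *)
have gain i0 j0 : i0 \in I -> j0 \in J ->
    c * s i0 j0 - M * s i0 j0 `^ (1 - sig) + h <= t i0 j0 -> dil_bound A.
  move=> i0I j0J gainP; apply: le_trans tA.
  pose u i j := t i j - (c * s i j - M * s i j `^ (1 - sig)).
  have u0 i j : i \in I -> j \in J -> 0 <= u i j.
    move=> iI jJ; rewrite subr_ge0.
    have [/andP[/eqP -> /eqP ->]|ne] := boolP ((i == i0) && (j == j0)).
      by apply: le_trans gainP; rewrite lerDl ltW.
    have [EA|ne'] := eqVneq (cls k (cls r A i) j) A.
      case/negP: ne; have AP x : x \in A -> r x = i /\ k x = j.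
        by rewrite -{1}EA !in_cls => /andP[/andP[_ /eqP ?] /eqP ?].
      move: i0I j0J => /imfsetP[x /= /AP[<- _] ->] /imfsetP[y /= /AP[_ <-] ->].
      by rewrite !eqxx.
    apply: le_trans (cell_t i j); apply: le_trans (IH _ (cellA i j) ne').
    by rewrite lerB // DM // powR_ge0.
  have uh : h <= \sum_(i <- I) \sum_(j <- J) u i j.
    rewrite (big_rem i0 i0I) /= (big_rem j0 j0J) /= -addrA ler_wpDr //.
      apply: addr_ge0; rewrite big_seq sumr_ge0 // => z /mem_rem zI; first exact: u0.
      by rewrite big_seq sumr_ge0 // => j jJ; apply: u0.
    by rewrite lerBrDl.
  have := @sum_powR2 I J s (c ^+ 2) (fun a b => ler0n _ _) IJc; rewrite sn.
  set S := \sum_(i <- I) \sum_(j <- J) s i j `^ (1 - sig) => SP.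
  have uE : \sum_(i <- I) \sum_(j <- J) u i j =
      \sum_(i <- I) \sum_(j <- J) t i j - (c * n - M * S).
    rewrite -sn /S !mulr_sumr -!sumrB; apply: eq_bigr => i _.
    by rewrite !mulr_sumr -!sumrB.
  have MS : M * S <= G + h.
    apply: (@le_trans _ _ (M * ((c ^+ 2) `^ sig * n `^ (1 - sig)))).
      by rewrite ler_wpM2l // mulr_ge0 ?powR_ge0.
    have -> : M * ((c ^+ 2) `^ sig * n `^ (1 - sig)) = (c ^+ 6) `^ sig * G.
      rewrite [c ^+ 6](exprD c 4 2) (powRM _ (exprn_ge0 4 (ltW c0)) (exprn_ge0 2 (ltW c0))) /M GE.
      by ring.
    by have := ler_wpM2r (ltW G0) c6; rewrite mulrDl mul1r -hE.
  have q : c * n - G <= \sum_(i <- I) \sum_(j <- J) t i j  by rewrite uE in uh; lra.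
  by move: q; rewrite GE.
have hn : 2 * c ^+ 2 * (c + 1) * h <= n.
  have : 2 * c ^+ 2 * (c + 1) * h <= (2 * c ^+ 3 * (c + 1) * eta) * n.
    rewrite hE; have -> : 2 * c ^+ 3 * (c + 1) * eta * n = 2 * c ^+ 2 * (c + 1) * (eta * (c * n)).
      by ring.
    apply: ler_wpM2l; last by rewrite ler_wpM2l // ltW.
    by rewrite !mulr_ge0 ?cX //; have := ltW c0; lra.
  by move=> /le_trans; apply; rewrite ler_piMl // ltW.
(* A cell [(i, j)] is small. Take the largest column [j']: either it outweighs [c] times the cell
   [(i, j')], which is a gain there, or that cell is large, so row [i] is large and outweighs [c]
   times the small cell. *)
have [[i [j [iI jJ sh]]]|all_h] := pselect (exists i j, [/\ i \in I, j \in J & s i j < h]).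
  have [j'] := @popular_fiber _ _ k A J A0 (fun x xA => in_imfset _ _ xA).
  rewrite -/(cls k A j') -(ler_nat R) natrM -/n => j'P.
  have nj' : n <= c * card (cls k A j') by apply: le_trans j'P _; rewrite ler_wpM2r.
  have j'J : j' \in J.
    have /fset0Pn[x] : cls k A j' != fset0.
      apply: contraTN nj' => /eqP ->; by rewrite cardfs0 mulr0 -ltNge.
    by rewrite in_cls => /andP[xA /eqP <-]; apply: in_imfset.
  have [_ t1 _] := t_ge i j' iI j'J; have [t2 _ _] := t_ge i j iI jJ.
  have sr : s i j' <= card (cls r A i) by rewrite ler_nat; apply/fsubset_leq_card/cls_sub.
  have M0 x : 0 <= M * x `^ (1 - sig) by rewrite !mulr_ge0 ?powR_ge0.
  have [le|lt] := leP (c * s i j' + h) (card (cls k A j')).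
    apply: (gain i j') => //; have := M0 (s i j'); lra.
  apply: (gain i j) => //.
  have n2 : n <= c ^+ 2 * s i j' + c * h.
    apply: le_trans nj' _; have -> : c ^+ 2 * s i j' + c * h = c * (c * s i j' + h) by ring.
    by rewrite ler_wpM2l // ltW.
  have ch : 2 * (c * h) <= n.
    have cc : c <= c ^+ 2 * (c + 1).
      apply: (@le_trans _ _ (c + 1)); first by rewrite lerDl.
      by apply: ler_peMl; [lra|exact: (exprn_ege1 2 c1)].
    by have := ler_wpM2r (ltW h0) cc; lra.
  have n3 : n <= 2 * c ^+ 2 * card (cls r A i).
    apply: (@le_trans _ _ (2 * c ^+ 2 * s i j')); first by lra.
    by rewrite ler_wpM2l // mulr_ge0 ?cX.
  have : (c + 1) * h <= card (cls r A i).
    rewrite -(ler_pM2l (mulr_gt0 (@ltr0Sn R 1) (exprn_gt0 2 c0))).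
    by apply: le_trans n3; rewrite mulrA.
  by have := M0 (s i j); have := ler_wpM2l (ltW c0) (ltW sh); lra.
have sh i j : i \in I -> j \in J -> h <= s i j.
  by move=> iI jJ; rewrite leNgt; apply/negP => ?; apply: all_h; exists i, j.
have piece i j : i \in I -> j \in J ->
    c * s i j - (2 * c ^+ 5 + 1) * h <= t i j \/
    c * s i j - M * s i j `^ (1 - sig) + h <= t i j.
  move=> iI jJ; pose E := cls k (cls r A i) j.
  have gainE : card (addf E (dilf lam E)) + h <= t i j ->
      c * s i j - M * s i j `^ (1 - sig) + h <= t i j.
    have [EA|ne'] := eqVneq E A.
      have [_ _ tA'] := t_ge i j iI jJ; rewrite EA; lra.
    apply: le_trans; rewrite lerD2r; apply: le_trans (IH _ (cellA i j) ne').
    by rewrite lerB // DM // powR_ge0.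
  have Er x : x \in E -> r x = i by rewrite !in_cls => /andP[/andP[_ /eqP]].
  have Ek x : x \in E -> k x = j by rewrite !in_cls => /andP[_ /eqP].
  have E0 : E != fset0 by rewrite -cardfs_eq0 -(pnatr_eq0 R) gt_eqF // (lt_le_trans h0) // sh.
  have /fset0Pn[x0 x0E] := E0.
  have EA : E `<=` A := cellA i j.
  (* Subrows are tested by moving along the column of [E], subcolumns below by moving along its row
     with [lam^-1]. *)
  have [|||full1|g1] := @full_or_gain lam A (cls k A j) E x0 h lam0 h0 x0E _ (cls_sub _ _ _).
  - by rewrite /E clsC; apply: cls_sub.
  - by move=> x /Er rx; rewrite -/r rx Er.
  - by move=> y yA; rewrite -/r clsC; apply: sh => //; apply: in_imfset.
  2: right; apply: gainE; apply: le_trans g1 _; rewrite ler_nat; apply/fsubset_leq_card/addfS.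
  2: exact: cls_sub.
  2: exact: fsubset_refl.
  have [|||full2|g2] := @full_or_gain lam^-1 A (cls r A i) E x0 h lamV0 h0 x0E _ (cls_sub _ _ _).
  - exact: cls_sub.
  - by move=> x /Ek kx; rewrite invrK -/k kx Ek.
  - by move=> y yA; rewrite invrK -/k; apply: sh => //; apply: in_imfset.
  2: right; apply: gainE; move: g2; rewrite !card_addf_dilV // => /le_trans; apply.
  2: rewrite ler_nat; apply/fsubset_leq_card/addfS; first exact: fsubset_refl.
  2: by apply: dilfS; rewrite /E clsC; apply: cls_sub.
  have p00 : p`_0 != 0.
    by apply: contraTN P1 => /eqP p00; rewrite PE p00 /= ler10.
  have [pmin' spE] := is_min_poly_int_rev lam0 pmin.
  have p0E : (Poly (rev p))`_0 = lead_coef p.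
    rewrite coef_Poly nth_rev ?subn1 // size_poly_gt0.
    by apply: contraNneq p00 => ->; rewrite coef0.
  have Ph := index_rows lam0 pmin pprim A1 full1.
  have := index_rows lamV0 pmin' (primitive_int_poly_rev p00 pprim) A1 full2.
  rewrite p0E invrK => Qh.
  have sub1 := card_subrows lam0 E0 EA.
  have sub2 := card_subrows lamV0 E0 EA; rewrite invrK symA in sub2.
  have bound (x y : R) : 0 <= y -> y <= c -> x * n <= y * card (addf A (dilf lam A)) -> x <= c ^+ 2.
    move=> y0 yc xy; rewrite -(ler_pM2r n0); apply: le_trans xy _.
    by rewrite expr2 -mulrA ler_pM.
  have PI : P <= card (crep A (lam^-1 ^+ 2) @` E) <= c ^+ 2.
    by apply/andP; split; [rewrite PE ler_nat|exact: bound Ic sub1].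
  have QJ : Q <= card (crep A (lam ^+ 2) @` E) <= c ^+ 2.
    by apply/andP; split; [rewrite QE ler_nat|exact: bound Jc sub2].
  have [||X XE XnE|d1|d2] := @piece_bound A E e h E0 EA _ _ PI QJ bmA e0 h0 eh.
  - by move=> x y xE yE; rewrite -/r !Er.
  - by move=> x y xE yE; rewrite -/k !Ek.
  - apply: IH; first exact: fsubset_trans EA.
    by apply: contraNneq XnE => XA; rewrite eqEfsubset XE XA EA.
  - by left; apply: le_trans (cell_t i j).
  - by right; apply: le_trans (cell_t i j).
have [[i [j [iI jJ gP]]]|nog] := pselect (exists i j, [/\ i \in I, j \in J &
    c * s i j - M * s i j `^ (1 - sig) + h <= t i j]); first exact: gain gP.
apply: le_trans tA; apply: (@le_trans _ _ (c * n - G)); first by rewrite GE.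
(* Without any gain all cells satisfy the direct bound, and the deficits of at most [c ^+ 2] cells
   fit into [G] by the choice of [eta]. *)
apply: (@le_trans _ _ (\sum_(i <- I) \sum_(j <- J) (c * s i j - (2 * c ^+ 5 + 1) * h))).
  under [leRHS]eq_bigr do rewrite sumrB -mulr_sumr sumr_const_seq.
  rewrite sumrB -mulr_sumr sn sumr_const_seq lerB // mulrA.
  apply: (@le_trans _ _ (c ^+ 2 * ((2 * c ^+ 5 + 1) * h))).
    rewrite ler_wpM2r // mulr_ge0 ?(ltW h0) //; have := cX 5; lra.
  rewrite hE !mulrA; apply: ler_piMl; [exact: ltW|move: eta2; rewrite !mulrA; exact].
rewrite big_seq [leRHS]big_seq; apply: ler_sum => i iI.
rewrite big_seq [leRHS]big_seq; apply: ler_sum => j jJ.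
by have [//|?] := piece i j iI jJ; case: nog; exists i, j.
Qed.

End Step.

(** * Choice of the constants and conclusion *)

Section Conclusion.
Variable R : realType.
Implicit Types (A X Y : {fset R}) (lam : R).
Local Notation card A := (#|` A|%:R : R).

Lemma zfree_powers lam p (z : R) : is_min_poly_int lam p -> z != 0 ->
  zfree (fun i => lam ^+ i * z) (size p).-1.
Proof.
move=> [p0 _ pmin] z0 k m kd [a aE].
have sp : (0 < size p)%N by rewrite size_poly_gt0.
pose q : {poly rat} := \poly_(i < k.+1) (if i == k then m%:~R else - (a i)%:~R).
have qk : q`_k = m%:~R by rewrite coef_poly ltnSn eqxx.
apply/eqP; apply: contraTT kd => m0; rewrite -leqNgt -ltnS prednK //.
apply: leq_trans (pmin q _ _) (size_poly _ _).
  by apply: contraNneq m0 => q0; rewrite -(intr_eq0 rat) -qk q0 coef0.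
rewrite (@horner_coef_wide _ k.+1) ?(leq_trans (size_poly _ _)) ?size_poly //.
rewrite big_ord_recr /= coef_map_id0 ?rmorph0 // qk ratr_int.
apply: (mulIf z0); rewrite mul0r mulrDl.
have -> : m%:~R * lam ^+ k * z = \sum_(i < k) (lam ^+ i * z) *~ a i by rewrite -aE -mulrA mulrzl.
rewrite mulr_suml -big_split big1 //= => i _.
rewrite coef_map_id0 ?rmorph0 // coef_poly ltnS (ltnW (ltn_ord i)) ltn_eqF ?ltn_ord //.
by rewrite rmorphN /= ratr_int -[_ *~ _]mulrzl; ring.
Qed.

Lemma min_poly_size_gt1 lam p : is_min_poly_int lam p -> (1 < size p)%N.
Proof.
move=> [p0 plam _]; rewrite ltnNge; apply/negP => /size1_polyC pE.
move: plam p0; rewrite pE map_polyC hornerC /= => /eqP.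
by rewrite intr_eq0 polyC_eq0 => ->.
Qed.

(** The bound is immediate unless [|A + lam A| <= c |A|], which makes [few_lines] available with
    [K = c], and unless the loss is at most [c |A|], which makes [h] small against [|A|]. *)
Lemma dil_bound_all lam p : lam != 0 -> is_min_poly_int lam p -> primitive_int_poly p ->
  exists D sig : R, [/\ 0 < D, 0 < sig & forall A,
    dil_bound lam (size p).-1 (absz (p`_0)%R)%:R (absz (lead_coef p))%:R D sig A].
Proof.
move=> lam0 pmin pprim.
have p00 := min_poly_coef0_neq0 lam0 pmin; have [p0 _ _] := pmin.
set d := (size p).-1; set P : R := (absz (p`_0)%R)%:R; set Q : R := (absz (lead_coef p))%:R.
have d0 : (0 < d)%N by have := min_poly_size_gt1 pmin; rewrite /d; case: (size p) => [|[]].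
have P1 : 1 <= P by rewrite ler1n absz_gt0.
have Q1 : 1 <= Q by rewrite ler1n absz_gt0 lead_coef_eq0.
have := bm_ge1 d0 P1 Q1; have bE : bm d Q P = bm d Q P by [].
move: {2 3}(bm d Q P) bE => c cE c1.
have c0 : 0 < c by apply: lt_le_trans c1.
have [C [s [C0 s0 s1 lines]]] := few_lines d lam0 (ltW c0).
pose CE : R := 2 ^+ d * (d%:R * C).
have CE0 : 0 < CE by rewrite !mulr_gt0 ?exprn_gt0 // ltr0n.
pose eta := (4 * c ^+ 8)^-1.
have c8 : 0 < 4 * c ^+ 8 by rewrite mulr_gt0 ?exprn_gt0.
have eta0 : 0 < eta by rewrite invr_gt0.
have cle m : (m <= 8)%N -> c ^+ m <= c ^+ 8 by move=> m8; apply: ler_weXn2l.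
have eta1 : 2 * c ^+ 3 * (c + 1) * eta <= 1.
  rewrite ler_pdivrMr // mul1r.
  have -> : 2 * c ^+ 3 * (c + 1) = 2 * c ^+ 4 + 2 * c ^+ 3 by ring.
  by have := cle 3%N isT; have := cle 4%N isT; lra.
have eta2 : c ^+ 2 * (2 * c ^+ 5 + 1) * eta <= 1.
  rewrite ler_pdivrMr // mul1r.
  have -> : c ^+ 2 * (2 * c ^+ 5 + 1) = 2 * c ^+ 7 + c ^+ 2 by ring.
  by have := cle 7%N isT; have := cle 2%N isT; have := exprn_gt0 8 c0; lra.
have c61 : 1 < c ^+ 6 + 1 by rewrite ltrDr exprn_gt0.
have ln0 : 0 < ln (c ^+ 6 + 1) by apply: ln_gt0.
(* The first bound keeps the line error below the gain, the second gives
   [(c ^+ 6) ^ sig <= 1 + eta]; adding 1 to [c ^+ 6] keeps the logarithm positive given only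
   [1 <= c]. *)
pose sig := Num.min s (ln (1 + eta) / ln (c ^+ 6 + 1)).
have sig0 : 0 < sig by rewrite lt_min s0 divr_gt0 // ln_gt0 // ltrDl.
have sigs : sig <= s by rewrite ge_min lexx.
have sig1 : sig < 1 by apply: le_lt_trans s1.
have c6 : (c ^+ 6) `^ sig <= 1 + eta.
  apply: (@le_trans _ _ ((c ^+ 6 + 1) `^ sig)).
    apply: ge0_ler_powR; rewrite ?nnegrE ?(ltW sig0) ?exprn_ge0 ?(ltW c0) ?lerDl //.
    by rewrite ltW // (lt_trans ltr01).
  rewrite /powR gt_eqF ?(lt_trans ltr01) // -[leRHS]lnK ?posrE ?addr_gt0 // ler_expR.
  by rewrite -ler_pdivlMr // ge_min lexx orbT.
(* The second summand gives [c ^+ 4 * CE <= eta * D]; exceeding [c] makes the bound trivial for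
   singletons. *)
pose D := c + c ^+ 4 * CE / eta.
have D0 : 0 < D by rewrite addr_gt0 // divr_gt0 // mulr_gt0 ?exprn_gt0.
exists D, sig; split=> // A; move: {2}#|` A| (leqnn #|` A|) => m.
elim: m A => [|m IHm] A Am.
  have -> : A = fset0 by apply/eqP; rewrite -cardfs_eq0 -leqn0.
  exact: dil_bound0 (ltW D0).
have [->|A0] := eqVneq A fset0; first exact: dil_bound0 (ltW D0).
have n0 : 0 < card A by rewrite ltr0n cardfs_gt0.
have [cn|/ltW small] := leP (c * card A) (card (addf A (dilf lam A))).
  rewrite /dil_bound cE; apply: le_trans cn.
  by rewrite gerBl mulr_ge0 ?powR_ge0 ?(ltW D0).
have [Gn|/ltW Gn] := leP (c * card A) (D * card A `^ (1 - sig)).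
  by rewrite /dil_bound cE (@le_trans _ _ 0) // subr_le0.
have A1 : (1 < #|` A|)%N.
  rewrite ltn_neqAle cardfs_gt0 A0 andbT; apply/eqP => A1; move: Gn.
  rewrite -A1 powR1 mulr1 mulr1 leNgt => /negP; apply.
  by rewrite ltrDl divr_gt0 // mulr_gt0 ?exprn_gt0.
have [z z0 zP] := lines A (conj A0 small).
pose e := CE * card A `^ (1 - s).
have e0 : 0 <= e by rewrite mulr_ge0 ?powR_ge0 ?(ltW CE0).
apply: (@dil_bound_step _ lam d P Q D sig lam0 d0 P1 Q1 (ltW D0) sig0 sig1 p A e eta) => //;
  rewrite ?cE //.
- move=> X Y X0 Y0 XA YA; rewrite -(card_dilf Y lam0).
  have YY : dilf lam Y != fset0 by rewrite -cardfs_eq0 card_dilf // cardfs_eq0.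
  apply: le_trans (brunn_minkowski (zfree_powers pmin z0) d0 X0 YY) _.
  rewrite lerD2l; apply: le_trans (line_errS _ _ (addfS XA (dilfS lam YA))) _.
  rewrite /line_err -/d /e /CE -!mulrA ler_wpM2l ?exprn_ge0 //.
  apply: (@le_trans _ _ (\sum_(i < d) C * card A `^ (1 - s))); first by apply: ler_sum => i _; apply: zP.
  by rewrite sumr_const card_ord -[leLHS]mulr_natl.
- have De : c ^+ 4 * CE <= eta * D.
    by rewrite mulrDr [eta * (_ / _)]mulrC divfK ?gt_eqF // lerDr mulr_ge0 ?ltW.
  rewrite /e (mulrA (c ^+ 4)) (mulrA eta); apply: ler_pM (powR_ge0 _ _) De _.
    by rewrite mulr_ge0 ?exprn_ge0 ?(ltW c0) ?(ltW CE0).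
  by apply: ler_powR; rewrite ?ler1n ?cardfs_gt0 // lerB.
move=> X XA XnA; apply: IHm; rewrite -ltnS; apply: leq_trans Am.
by apply: fproper_ltn_card; rewrite fproperEneq XnA.
Qed.

End Conclusion.

Lemma sumset_dilE (R : realType) (A : {fset R}) (lam : R) : sumset_dil A lam = addf A (dilf lam A).
Proof.
apply/fsetP => x; apply/imfset2P/addfP => [[a /= aA [b /= bA ->]]|[a [_ [aA /dilfP[b bA ->] ->]]]].
  by exists a, (lam * b); rewrite mem_dilf.
by exists a => //; exists b.
Qed.

Local Open Scope fset_scope.

Theorem theorem1p5 (R : realType) (lam : R) (p : {poly int}) :
  is_min_poly_int lam p ->
  primitive_int_poly p ->
  let d := (size p).-1 in
  let ad : R := `|lead_coef p|%:~R in
  let a0 : R := `|p`_0|%:~R in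
  exists D : R, exists sigma : R, 0 < D /\ 0 < sigma /\
    forall A : {fset R},
      ((#|` sumset_dil A lam|)%:R : R) >=
        (ad `^ (d%:R)^-1 + a0 `^ (d%:R)^-1) ^+ d * (#|` A|)%:R
        - D * ((#|` A|)%:R `^ (1 - sigma)).
Proof.
move=> pmin pprim d ad a0.
have absR (z : int) : (`|z|%:~R : R) = (absz z)%:R by rewrite -abszE pmulrn.
have [lam0|lam0] := eqVneq lam 0; last first.
  have [D [sig [D0 sig0 bound]]] := dil_bound_all lam0 pmin pprim.
  exists D, sig; split=> //; split=> // A.
  rewrite /ad /a0 !absR sumset_dilE; exact: bound.
have [p0 plam _] := pmin.
(* For [lam = 0] the polynomial [p] divides ['X] over the integers, so [|a_d| = 1] and [a_0 = 0]:
   the constant is 1, and [A] is contained in the sumset. *)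
have [q qE] : exists q, 'X = (q * p)%R.
  by apply: (gauss_dvd pmin pprim); rewrite lam0 map_polyX hornerX.
have p00 : p`_0 = 0.
  apply/eqP; rewrite -(intr_eq0 R); apply/eqP; rewrite -[RHS]plam lam0 horner_coef0.
  by rewrite coef_map_id0.
have p1 : absz (lead_coef p) = 1%N.
  have := congr1 (fun u : {poly int} => absz (lead_coef u)) qE.
  by rewrite lead_coefX lead_coefM abszM => /esym/eqP; rewrite muln_eq1 => /andP[_ /eqP].
exists 1, 1; split=> //; split=> // A.
have d0 : (0 < d)%N.
  by have := min_poly_size_gt1 pmin; rewrite /d; case: (size p) => [|[]].
have -> : ad = 1 by rewrite /ad absR p1.
have -> : a0 = 0 by rewrite /a0 p00.
rewrite powR1 powR0 ?invr_eq0 ?pnatr_eq0 -?lt0n // addr0 expr1n mul1r.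
apply: (@le_trans _ _ #|` A|%:R); first by rewrite gerBl mulr_ge0 ?powR_ge0.
rewrite ler_nat; apply/fsubset_leq_card/fsubsetP => a aA.
by apply/imfset2P; exists a => //; exists a => //; rewrite lam0 mul0r addr0.
Qed.
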